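(* Let $\Bbbk$ be an algebraically closed field, let $n\in\mathbb{Z}_{>0}$, and let $\Lambda$ be a basic, connected, finite-dimensional $\Bbbk$-algebra with exactly $n$ isomorphism classes of simple modules, which is quasi-hereditary with respect to some order $L_1<L_2<\dots<L_n$ on a full set of representatives of the isomorphism classes of simple $\Lambda$-modules. Assume the following: (a) Exactly $n-1$ of the (isomorphism classes of) indecomposable projective $\Lambda$-modules are injective. (b) The algebra $\Lambda$ has a simple preserving duality. Then $n>1$ and $\Lambda\cong B_n$ as $\Bbbk$-algebras.
   Context: Modules are finite-dimensional right modules. Quasi-hereditary: let $\Lambda$ be a finite-dimensional $\Bbbk$-algebra with a fixed order $L_1<L_2<\dots<L_k$ on a full set of representatives of simple $\Lambda$-modules, and let $P_i$ be the indecomposable projective cover of $L_i$. Then $\Lambda$ is quasi-hereditary (with respect to $<$) provided that there are $\Lambda$-modules $\Delta_i$, $i=1,\dots,k$ (standard modules), such that: there is a surjection $P_i\twoheadrightarrow\Delta_i$ whose kernel has a filtration with subquotients $\Delta_j$ with $j>i$; and there is a surjection $\Delta_i\twoheadrightarrow L_i$ whose kernel has composition subquotients $L_j$ with $j<i$. A simple preserving duality of $\Lambda$ is an involutive contravariant autoequivalence of the category of $\Lambda$-modules which preserves the isomorphism classes of simple modules. The algebra $B_n$ ($n\geq 2$): consider the quiver with vertices $1,2,\dots,n$ and, for each $1\leq i\leq n-1$, one arrow $i\to i+1$ and one arrow $i+1\to i$. Then $B_n$ is the quotient of the path algebra over $\Bbbk$ of this quiver by the ideal generated by the relations: any path of length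 three is zero; any path of length two which is not a cycle is zero; for each vertex $v$, all length two cycles which start and terminate at $v$ are equal; the length two cycle at the vertex $n$ is zero. *)

(* Defs.v *)
From HB Require Import structures.
From mathcomp Require Import all_boot all_order all_algebra all_field.
From mathcomp Require Import generic_quotient finmap boolp monalg.

Set Implicit Arguments.
Unset Strict Implicit.
Unset Printing Implicit Defensive.

Import GRing.Theory.
Local Open Scope ring_scope.

Record rmod (K : fieldType) (A : falgType K) := RMod {
  rcar :> vectType K;
  ract : rcar -> A -> rcar;
  ract_linearl : forall a, linear (fun m => ract m a);
  ract_linearr : forall m, linear (ract m);
  ract1 : forall m, ract m 1 = m;
  ractM : forall m a b, ract m (a * b) = ract (ract m a) b
}.

Record rhom (K : fieldType) (A : falgType K) (M N : rmod A) := RHom {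
  rfun :> 'Hom(M, N);
  rfunP : forall m a, rfun (ract m a) = ract (rfun m) a
}.

Section Modules.
Variables (K : fieldType) (A : falgType K).
Implicit Types M N P : rmod A.

Lemma rid_subproof M (m : M) a :
  (\1%VF : 'End(M)) (ract m a) = ract ((\1%VF : 'End(M)) m) a.
Proof. by rewrite !id_lfunE. Qed.

Definition rid M : rhom M M := RHom (@rid_subproof M).

Lemma rcomp_subproof M N P (g : rhom N P) (f : rhom M N) (m : M) a :
  (rfun g \o rfun f)%VF (ract m a) = ract ((rfun g \o rfun f)%VF m) a.
Proof. by rewrite !comp_lfunE !rfunP. Qed.

Definition rcomp M N P (g : rhom N P) (f : rhom M N) : rhom M P :=
  RHom (rcomp_subproof g f).

Lemma regular_linearl (a : A) : linear (fun m : A => m * a).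
Proof. by move=> c x y; rewrite mulrDl scalerAl. Qed.

Lemma regular_linearr (m : A) : linear (fun a : A => m * a).
Proof. by move=> c x y; rewrite mulrDr scalerAr. Qed.

Definition regular_rmod : rmod A :=
  @RMod K A A (fun m a => m * a) regular_linearl regular_linearr
    (@mulr1 A) (@mulrA A).

Definition rmod_iso M N : Prop := exists f : rhom M N, bijective f.

Definition submodule M (U : {vspace M}) : Prop :=
  forall m a, m \in U -> ract m a \in U.

Definition simple_rmod M : Prop :=
  (fullv : {vspace M}) <> 0%VS /\
  forall U : {vspace M}, submodule U -> U = 0%VS \/ U = fullv.

Definition indecomposable M : Prop :=
  (fullv : {vspace M}) <> 0%VS /\
  forall U V : {vspace M}, submodule U -> submodule V ->
    (U + V)%VS = fullv -> (U :&: V)%VS = 0%VS -> U = 0%VS \/ V = 0%VS.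

Definition surjective_rhom M N (f : rhom M N) : Prop := limg f = fullv.

Definition projective_rmod P : Prop :=
  forall M N (g : rhom M N) (f : rhom P N), surjective_rhom g ->
    exists h : rhom P M, rcomp g h = f.

Definition injective_rmod P : Prop :=
  forall M N (g : rhom M N) (f : rhom M P), injective g ->
    exists h : rhom N P, rcomp h g = f.

Definition projective_cover P M : Prop :=
  projective_rmod P /\
  exists p : rhom P M, surjective_rhom p /\
    forall U : {vspace P}, submodule U -> (U + lker p)%VS = fullv -> U = fullv.

Definition short_exact M N P (f : rhom M N) (g : rhom N P) : Prop :=
  [/\ injective f, limg f = lker g & surjective_rhom g].

(* A chain 0 = M_0 <= M_1 <= ... <= M_r = M of submodules whose subquotients  *)
(* M_{s+1} / M_s satisfy C, built from the bottom by short exact sequences    *)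
(* 0 -> M_s -> M_{s+1} -> M_{s+1} / M_s -> 0.                                 *)
Inductive filtered (C : rmod A -> Prop) : rmod A -> Prop :=
| filtered0 M : (fullv : {vspace M}) = 0%VS -> filtered C M
| filteredS M' M M'' (f : rhom M' M) (g : rhom M M'') :
    short_exact f g -> filtered C M' -> C M'' -> filtered C M.

(* Exactness makes Z the kernel of the surjection g from M onto N.            *)
Definition surjects_with_kernel M N (C : rmod A -> Prop) : Prop :=
  exists (Z : rmod A) (f : rhom Z M) (g : rhom M N),
    short_exact f g /\ filtered C Z.

(* The isomorphism classes of modules satisfying C are exactly m in number.   *)
Definition representatives (C : rmod A -> Prop) m (Q : 'I_m -> rmod A) : Prop :=
  [/\ forall i, C (Q i),
      forall i j, rmod_iso (Q i) (Q j) -> i = j &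
      forall M, C M -> exists i, rmod_iso M (Q i)].

Definition direct_sum_of M m (Q : 'I_m -> rmod A) : Prop :=
  exists f : forall i, rhom (Q i) M,
    [/\ forall i, injective (f i),
        directv (\sum_(i < m) limg (f i)) &
        (\sum_(i < m) limg (f i))%VS = fullv].

(* The order on the simple modules L 0, L 1, ... is that of their indices.    *)
Definition quasi_hereditary k (L : 'I_k -> rmod A) : Prop :=
  exists P Delta : 'I_k -> rmod A, forall i,
    [/\ projective_cover (P i) (L i),
        surjects_with_kernel (P i) (Delta i)
          (fun M => exists2 j : 'I_k, (i < j)%N & rmod_iso M (Delta j)) &
        surjects_with_kernel (Delta i) (L i)
          (fun M => exists2 j : 'I_k, (j < i)%N & rmod_iso M (L j))].

Definition basic_algebra : Prop :=
  exists m (Q : 'I_m -> rmod A),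
    [/\ direct_sum_of regular_rmod Q,
        forall i, indecomposable (Q i) &
        forall i j, rmod_iso (Q i) (Q j) -> i = j].

(* A is not a product of two nonzero algebras: since A is nonzero, this means *)
(* that its only central idempotents are 0 and 1.                             *)
Definition connected_algebra : Prop :=
  forall e : A, e * e = e -> (forall a, e * a = a * e) -> e = 0 \/ e = 1.

Record contrafunctor := ContraFunctor {
  cobj :> rmod A -> rmod A;
  cmap : forall M N, rhom M N -> rhom (cobj N) (cobj M);
  cmap_id : forall M, cmap (rid M) = rid (cobj M);
  cmap_comp : forall M N P (g : rhom N P) (f : rhom M N),
    cmap (rcomp g f) = rcomp (cmap f) (cmap g)
}.

(* D o D is naturally isomorphic to the identity, so that D is its own        *)
(* quasi-inverse.                                                             *)
Definition involutive_duality (D : contrafunctor) : Prop :=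
  exists eta : forall M, rhom M (D (D M)),
    (forall M, bijective (eta M)) /\
    (forall M N (f : rhom M N),
       rcomp (eta N) f = rcomp (cmap D (cmap D f)) (eta M)).

Definition has_simple_preserving_duality : Prop :=
  exists D : contrafunctor,
    involutive_duality D /\ (forall S, simple_rmod S -> rmod_iso (D S) S).

End Modules.

Record quiver := Quiver {
  vertex : finType;
  arrow : finType;
  qsrc : arrow -> vertex;
  qtgt : arrow -> vertex
}.

(* A path is a starting vertex with a composable sequence of arrows; the      *)
(* empty sequence gives the trivial path at that vertex.                      *)
Fixpoint composable (Q : quiver) (v : vertex Q) (s : seq (arrow Q)) : bool :=
  if s is a :: s' then (qsrc a == v) && composable (qtgt a) s' else true.

Record qpath (Q : quiver) := QPath {
  qpath_val : vertex Q * seq (arrow Q);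
  _ : composable qpath_val.1 qpath_val.2
}.

HB.instance Definition _ Q := [isSub for @qpath_val Q].
HB.instance Definition _ Q := [Choice of qpath Q by <:].

Section Paths.
Variable Q : quiver.
Implicit Types (v : vertex Q) (s : seq (arrow Q)) (p q r : qpath Q).

Definition psrc p : vertex Q := (val p).1.
Definition parrows p : seq (arrow Q) := (val p).2.
Definition ptgt p : vertex Q := last (psrc p) (map (@qtgt Q) (parrows p)).
Definition plength p : nat := size (parrows p).
Definition ptrivial v : qpath Q := @QPath Q (v, [::]) isT.

Lemma composable_cat v s t :
  composable v (s ++ t) =
  composable v s && composable (last v (map (@qtgt Q) s)) t.
Proof. by elim: s v => //= a s IH v; rewrite IH andbA. Qed.

Lemma pcat_subproof p q (e : ptgt p = psrc q) :
  composable (psrc p, parrows p ++ parrows q).1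
             (psrc p, parrows p ++ parrows q).2.
Proof.
rewrite /= composable_cat (valP p) /=.
by rewrite -[last _ _]/(ptgt p) e; exact: (valP q).
Qed.

Definition pcat p q : option (qpath Q) :=
  if @eqP _ (ptgt p) (psrc q) is ReflectT e
  then Some (QPath (pcat_subproof e)) else None.

Variant pcat_spec p q : option (qpath Q) -> Type :=
| PCatSome r of ptgt p = psrc q & psrc r = psrc p & ptgt r = ptgt q
    & parrows r = parrows p ++ parrows q : pcat_spec p q (Some r)
| PCatNone of ptgt p <> psrc q : pcat_spec p q None.

Lemma pcatP p q : pcat_spec p q (pcat p q).
Proof.
rewrite /pcat; case: eqP => [e|ne]; constructor=> //.
rewrite {1}/ptgt /psrc /parrows /= map_cat last_cat.
exact: (congr1 (fun v => last v _) e).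
Qed.

Lemma qpath_inj p q : psrc p = psrc q -> parrows p = parrows q -> p = q.
Proof.
case: p q => [[v s] Hp] [[w t] Hq]; rewrite /psrc /parrows /= => e1 e2.
by apply: val_inj; rewrite /= e1 e2.
Qed.

Lemma pcatA p q r :
  obind (pcat p) (pcat q r) = obind (fun x => pcat x r) (pcat p q).
Proof.
case: (pcatP q r) => [x qr sx tx ax|nqr] /=;
  case: (pcatP p q) => [y pq sy ty ay|npq] //=.
- case: (pcatP p x) => [z pz sz tz az|[]]; last by rewrite sx.
  case: (pcatP y r) => [w yr sw tw aw|[]]; last by rewrite ty.
  congr Some; apply: qpath_inj; first by rewrite sz sw sy.
  by rewrite az aw ax ay catA.
- by case: (pcatP p x) => // z; rewrite sx.
- by case: (pcatP y r) => // z; rewrite ty.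
Qed.

Lemma pcat1l v q : pcat (ptrivial v) q = if v == psrc q then Some q else None.
Proof.
case: (pcatP (ptrivial v) q) => [x e sx tx ax|e]; last by move/eqP/negbTE: e => ->.
have -> : v == psrc q by apply/eqP.
by congr Some; apply: qpath_inj => //; rewrite sx -e.
Qed.

Lemma pcat1r v p : pcat p (ptrivial v) = if ptgt p == v then Some p else None.
Proof.
case: (pcatP p (ptrivial v)) => [x e sx tx ax|e]; last by move/eqP/negbTE: e => ->.
have -> : ptgt p == v by apply/eqP.
by congr Some; apply: qpath_inj => //; rewrite ax cats0.
Qed.

End Paths.

(* The vector space with basis the paths of Q.                                *)
Definition path_algebra (K : fieldType) (Q : quiver) := {malg K[qpath Q]}.

HB.instance Definition _ K Q := GRing.Lmodule.on (path_algebra K Q).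

HB.lock Definition pbasis (K : fieldType) (Q : quiver) (p : qpath Q) :
  path_algebra K Q := << p >>.
Arguments pbasis K {Q} p.

Definition obasis (K : fieldType) (Q : quiver) (o : option (qpath Q)) :
  path_algebra K Q := if o is Some p then pbasis K p else 0.
Arguments obasis K {Q} o.

(* The product of paths p * q is p followed by q. The choice between this and *)
(* the opposite product does not matter for B_n, whose relations are stable   *)
(* under reversing all paths.                                                 *)
HB.lock Definition pmul (K : fieldType) (Q : quiver) (f g : path_algebra K Q) :
  path_algebra K Q :=
  \sum_(p <- msupp f) \sum_(q <- msupp g)
    (mcoeff p f * mcoeff q g) *: obasis K (pcat p q).

Lemma malgU_scale (T : choiceType) (K : fieldType) (c : K) (t : T) :
  << c *g t >> = c *: << t >> :> {malg K[T]}.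
Proof. by apply/malgP=> u; rewrite mcoeffZ !mcoeffU mulrnAr mulr1. Qed.

Section PathAlgebra.
Variables (K : fieldType) (Q : quiver).
Local Notation kQ := (path_algebra K Q).
Local Notation pbasis := (@pbasis K Q).
Local Notation obasis := (@obasis K Q).
Local Notation pmul := (@pmul K Q).
Implicit Types (f g h : kQ) (p q : qpath Q).

Definition pone : kQ := \sum_(v : vertex Q) pbasis (ptrivial v).

Lemma pmulEw (d1 d2 : {fset qpath Q}) f g :
  (msupp f `<=` d1)%fset -> (msupp g `<=` d2)%fset ->
  pmul f g = \sum_(p <- d1) \sum_(q <- d2)
    (mcoeff p f * mcoeff q g) *: obasis (pcat p q).
Proof.
move=> s1 s2; rewrite pmul.unlock (big_fset_incl _ s1) /=.
  apply/eq_bigr=> p _; apply/big_fset_incl => // q _ /mcoeff_outdom ->.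
  by rewrite mulr0 scale0r.
by move=> p _ /mcoeff_outdom e; rewrite big1 // => q _; rewrite e mul0r scale0r.
Qed.

Lemma pmulDl : left_distributive pmul +%R.
Proof.
move=> f g h.
rewrite (pmulEw (msuppD_le f g) (fsubset_refl _)).
rewrite (pmulEw (fsubsetUl (msupp f) (msupp g)) (fsubset_refl (msupp h))).
rewrite (pmulEw (fsubsetUr (msupp f) (msupp g)) (fsubset_refl (msupp h))).
rewrite -big_split; apply/eq_bigr=> p _; rewrite -big_split; apply/eq_bigr=> q _.
by rewrite mcoeffD mulrDl scalerDl.
Qed.

Lemma pmulDr : right_distributive pmul +%R.
Proof.
move=> f g h.
rewrite (pmulEw (fsubset_refl _) (msuppD_le g h)).
rewrite (pmulEw (fsubset_refl (msupp f)) (fsubsetUl (msupp g) (msupp h))).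
rewrite (pmulEw (fsubset_refl (msupp f)) (fsubsetUr (msupp g) (msupp h))).
rewrite -big_split; apply/eq_bigr=> p _; rewrite -big_split; apply/eq_bigr=> q _.
by rewrite mcoeffD mulrDr scalerDl.
Qed.

Lemma pmul0l g : pmul 0 g = 0.
Proof. by rewrite pmul.unlock msupp0 big_seq_fset0. Qed.

Lemma pmul0r f : pmul f 0 = 0.
Proof. by rewrite pmul.unlock big1 // => p _; rewrite msupp0 big_seq_fset0. Qed.

Lemma pmulZl c f g : pmul (c *: f) g = c *: pmul f g.
Proof.
rewrite (pmulEw (msuppZ_le c f) (fsubset_refl (msupp g))).
rewrite (pmulEw (fsubset_refl (msupp f)) (fsubset_refl (msupp g))) scaler_sumr.
apply/eq_bigr=> p _; rewrite scaler_sumr; apply/eq_bigr=> q _.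
by rewrite mcoeffZ scalerA mulrA.
Qed.

Lemma pmulZr c f g : pmul f (c *: g) = c *: pmul f g.
Proof.
rewrite (pmulEw (fsubset_refl (msupp f)) (msuppZ_le c g)).
rewrite (pmulEw (fsubset_refl (msupp f)) (fsubset_refl (msupp g))) scaler_sumr.
apply/eq_bigr=> p _; rewrite scaler_sumr; apply/eq_bigr=> q _.
by rewrite mcoeffZ scalerA mulrCA.
Qed.

Lemma pbasisE f : f = \sum_(p <- msupp f) mcoeff p f *: pbasis p.
Proof.
rewrite {1}[f]monalgE; apply/eq_bigr=> p _.
by rewrite pbasis.unlock; exact: malgU_scale.
Qed.

Lemma pbasis_ind (P : kQ -> Prop) :
  P 0 -> (forall f g, P f -> P g -> P (f + g)) ->
  (forall c f, P f -> P (c *: f)) -> (forall p, P (pbasis p)) -> forall f, P f.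
Proof.
by move=> P0 PD PZ Pb f; rewrite [f]pbasisE; apply: big_ind => // p _; exact: PZ.
Qed.

Lemma pmul_basis p q : pmul (pbasis p) (pbasis q) = obasis (pcat p q).
Proof.
rewrite pbasis.unlock (pmulEw (msuppU_le) (msuppU_le)) !big_seq_fset1 !mcoeffUU.
by rewrite mulr1 scale1r.
Qed.

Lemma pmul_obasisl o q :
  pmul (obasis o) (pbasis q) = obasis (obind (fun x => pcat x q) o).
Proof. by case: o => [p|] /=; rewrite ?pmul_basis ?pmul0l. Qed.

Lemma pmul_obasisr p o :
  pmul (pbasis p) (obasis o) = obasis (obind (pcat p) o).
Proof. by case: o => [q|] /=; rewrite ?pmul_basis ?pmul0r. Qed.

Lemma pmulA : associative pmul.
Proof.
move=> f g h; elim/pbasis_ind: f => [|f1 f2 IH1 IH2|c f IH|p].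
- by rewrite !pmul0l.
- by rewrite !pmulDl IH1 IH2.
- by rewrite !pmulZl IH.
elim/pbasis_ind: g => [|g1 g2 IH1 IH2|c g IH|q].
- by rewrite pmul0r !pmul0l pmul0r.
- by rewrite pmulDl !pmulDr pmulDl IH1 IH2.
- apply: (etrans (congr1 (pmul _) (pmulZl c g h))).
  apply: (etrans (pmulZr c (pbasis p) (pmul g h))); rewrite IH; apply: esym.
  exact: (etrans (congr1 (pmul^~ h) (pmulZr c (pbasis p) g)) (pmulZl _ _ _)).
elim/pbasis_ind: h => [|h1 h2 IH1 IH2|c h IH|r].
- by rewrite !pmul0r.
- by rewrite !pmulDr IH1 IH2.
- by rewrite !pmulZr IH.
by rewrite !pmul_basis pmul_obasisl pmul_obasisr pcatA.
Qed.

Lemma pmul1l : left_id pone pmul.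
Proof.
elim/pbasis_ind => [|f1 f2 IH1 IH2|c f IH|p].
- by rewrite pmul0r.
- by rewrite pmulDr IH1 IH2.
- by rewrite pmulZr IH.
rewrite /pone (big_morph (pmul^~ _) (fun _ _ => pmulDl _ _ _) (pmul0l _)).
rewrite (bigD1 (psrc p)) //= pmul_basis pcat1l eqxx /= big1 ?addr0 // => v.
by rewrite pmul_basis pcat1l => /negbTE->.
Qed.

Lemma pmul1r : right_id pone pmul.
Proof.
elim/pbasis_ind => [|f1 f2 IH1 IH2|c f IH|p].
- by rewrite pmul0l.
- by rewrite pmulDl IH1 IH2.
- by rewrite pmulZl IH.
rewrite /pone (big_morph (pmul _) (fun _ _ => pmulDr _ _ _) (pmul0r _)).
rewrite (bigD1 (ptgt p)) //= pmul_basis pcat1r eqxx /= big1 ?addr0 // => v.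
by rewrite pmul_basis pcat1r eq_sym => /negbTE->.
Qed.

HB.instance Definition _ := GRing.Zmodule_isPzRing.Build (path_algebra K Q)
  pmulA pmul1l pmul1r pmulDl pmulDr.

Lemma path_scalerAl (c : K) f g : c *: (f * g) = (c *: f) * g.
Proof. by rewrite -[RHS]/(pmul (c *: f) g) pmulZl. Qed.

Lemma path_scalerAr (c : K) f g : c *: (f * g) = f * (c *: g).
Proof. by rewrite -[RHS]/(pmul f (c *: g)) pmulZr. Qed.

End PathAlgebra.

Definition two_sided_ideal (R : pzRingType) (I : R -> Prop) : Prop :=
  [/\ I 0, forall x y, I x -> I y -> I (x + y),
      forall a x, I x -> I (a * x) & forall a x, I x -> I (x * a)].

Definition ideal_generated (R : pzRingType) (S : R -> Prop) (x : R) : Prop :=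
  forall I : R -> Prop, two_sided_ideal I -> (forall y, S y -> I y) -> I x.

Section BoundQuiverAlgebra.
Variables (K : fieldType) (Q : quiver) (S : path_algebra K Q -> Prop).
Local Notation kQ := (path_algebra K Q).
Local Notation J := (ideal_generated S).

Lemma ideal_generatedP : two_sided_ideal J.
Proof.
split=> [I|x y Jx Jy I|a x Jx I|a x Jx I] idI SI; case: (idI) => I0 ID Il Ir.
- exact: I0.
- by apply: ID; [exact: Jx|exact: Jy].
- by apply: Il; exact: Jx.
- by apply: Ir; exact: Jx.
Qed.

Lemma J0 : J 0. Proof. by case: ideal_generatedP. Qed.
Lemma JD x y : J x -> J y -> J (x + y).
Proof. by case: ideal_generatedP => _ + _ _; apply. Qed.
Lemma JMl a x : J x -> J (a * x).
Proof. by case: ideal_generatedP => _ _ + _; apply. Qed.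
Lemma JMr a x : J x -> J (x * a).
Proof. by case: ideal_generatedP => _ _ _; apply. Qed.
Lemma JN x : J x -> J (- x).
Proof. by move=> Jx; rewrite -mulN1r; apply: JMl. Qed.
Lemma JZ (c : K) x : J x -> J (c *: x).
Proof. by move=> Jx; rewrite -[x]mul1r path_scalerAl; apply: JMl. Qed.

Definition ideal_rel (x y : kQ) : bool := `[< J (x - y) >].

Lemma ideal_relP x y : reflect (J (x - y)) (ideal_rel x y).
Proof. exact: asboolP. Qed.

Lemma ideal_rel_refl : reflexive ideal_rel.
Proof. by move=> x; apply/ideal_relP; rewrite subrr; exact: J0. Qed.

Lemma ideal_rel_sym : symmetric ideal_rel.
Proof.
by move=> x y; apply/ideal_relP/ideal_relP => /JN; rewrite opprB.
Qed.

Lemma ideal_rel_trans : transitive ideal_rel.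
Proof.
move=> y x z /ideal_relP h1 /ideal_relP h2; apply/ideal_relP.
by rewrite -(subrKA y); exact: JD.
Qed.

Canonical ideal_equiv : equiv_rel kQ :=
  EquivRel ideal_rel ideal_rel_refl ideal_rel_sym ideal_rel_trans.

Local Open Scope quotient_scope.
Definition bound_quiver_algebra := {eq_quot ideal_equiv}.
HB.instance Definition _ := Choice.on bound_quiver_algebra.
HB.instance Definition _ := EqQuotient.on bound_quiver_algebra.
Local Notation qA := bound_quiver_algebra.
Local Open Scope quotient_scope.

Lemma qpiP x y : reflect (J (x - y)) (\pi_qA x == \pi_qA y).
Proof. by rewrite eqmodE; exact: ideal_relP. Qed.

Lemma qpi_eq x y : J (x - y) -> \pi_qA x = \pi_qA y.
Proof. by move/qpiP/eqP. Qed.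

Lemma qreprP x : J (repr (\pi_qA x) - x).
Proof. by apply/qpiP; rewrite reprK. Qed.

Variant qA_spec : qA -> Prop := QASpec x : qA_spec (\pi_qA x).
Lemma qAP a : qA_spec a. Proof. by rewrite -[a]reprK. Qed.

Definition qadd (a b : qA) : qA := \pi_qA (repr a + repr b).
Definition qopp (a : qA) : qA := \pi_qA (- repr a).
Definition qmul (a b : qA) : qA := \pi_qA (repr a * repr b).
Definition qscale (c : K) (a : qA) : qA := \pi_qA (c *: repr a).

Lemma qaddE x y : qadd (\pi_qA x) (\pi_qA y) = \pi_qA (x + y).
Proof.
by apply: qpi_eq; rewrite opprD addrACA; apply: JD; exact: qreprP.
Qed.

Lemma qoppE x : qopp (\pi_qA x) = \pi_qA (- x).
Proof. by apply: qpi_eq; rewrite -opprD; apply: JN; exact: qreprP. Qed.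

Lemma qmulE x y : qmul (\pi_qA x) (\pi_qA y) = \pi_qA (x * y).
Proof.
apply: qpi_eq; rewrite -(subrKA (x * repr (\pi_qA y))) -mulrBl -mulrBr.
by apply: JD; [apply: JMr|apply: JMl]; exact: qreprP.
Qed.

Lemma qscaleE c x : qscale c (\pi_qA x) = \pi_qA (c *: x).
Proof. by apply: qpi_eq; rewrite -scalerBr; apply: JZ; exact: qreprP. Qed.

Let qE := (qaddE, qoppE, qmulE, qscaleE).

Local Opaque qadd qopp qmul qscale.

Lemma qaddA : associative qadd.
Proof.
by case/qAP=> x; case/qAP=> y; case/qAP=> z; rewrite !qE addrA.
Qed.
Lemma qaddC : commutative qadd.
Proof. by case/qAP=> x; case/qAP=> y; rewrite !qE addrC. Qed.
Lemma qadd0 : left_id (\pi_qA 0) qadd.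
Proof. by case/qAP=> x; rewrite !qE add0r. Qed.
Lemma qaddN : left_inverse (\pi_qA 0) qopp qadd.
Proof. by case/qAP=> x; rewrite !qE addNr. Qed.

HB.instance Definition _ := GRing.isZmodule.Build bound_quiver_algebra
  qaddA qaddC qadd0 qaddN.

Lemma qmulA : associative qmul.
Proof.
by case/qAP=> x; case/qAP=> y; case/qAP=> z; rewrite !qE mulrA.
Qed.
Lemma qmul1l : left_id (\pi_qA 1) qmul.
Proof. by case/qAP=> x; rewrite !qE mul1r. Qed.
Lemma qmul1r : right_id (\pi_qA 1) qmul.
Proof. by case/qAP=> x; rewrite !qE mulr1. Qed.
Lemma qmulDl : left_distributive qmul (@GRing.add qA).
Proof.
case/qAP=> x; case/qAP=> y; case/qAP=> z.
by rewrite -![_ + _]/(qadd _ _) !qE mulrDl.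
Qed.
Lemma qmulDr : right_distributive qmul (@GRing.add qA).
Proof.
case/qAP=> x; case/qAP=> y; case/qAP=> z.
by rewrite -![_ + _]/(qadd _ _) !qE mulrDr.
Qed.

HB.instance Definition _ := GRing.Zmodule_isPzRing.Build bound_quiver_algebra
  qmulA qmul1l qmul1r qmulDl qmulDr.

Lemma qscaleA c d (a : qA) : qscale c (qscale d a) = qscale (c * d) a.
Proof. by case/qAP: a => x; rewrite !qE scalerA. Qed.
Lemma qscale1 : left_id 1 qscale.
Proof. by case/qAP=> x; rewrite !qE scale1r. Qed.
Lemma qscaleDr : right_distributive qscale +%R.
Proof.
move=> c; case/qAP=> x; case/qAP=> y.
by rewrite -![_ + _]/(qadd _ _) !qE scalerDr.
Qed.
Lemma qscaleDl (a : qA) : {morph qscale^~ a : c d / c + d}.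
Proof.
case/qAP: a => x c d.
by rewrite -[_ + qscale _ _]/(qadd _ _) !qE scalerDl.
Qed.

HB.instance Definition _ := GRing.Zmodule_isLmodule.Build K bound_quiver_algebra
  qscaleA qscale1 qscaleDr qscaleDl.

Lemma bqa_scalerAl (c : K) (a b : qA) : c *: (a * b) = (c *: a) * b.
Proof.
case/qAP: a => x; case/qAP: b => y.
rewrite -[LHS]/(qscale c (qmul _ _)) -[RHS]/(qmul (qscale _ _) _).
by rewrite !qE path_scalerAl.
Qed.

Lemma bqa_scalerAr (c : K) (a b : qA) : c *: (a * b) = a * (c *: b).
Proof.
case/qAP: a => x; case/qAP: b => y.
rewrite -[LHS]/(qscale c (qmul _ _)) -[RHS]/(qmul _ (qscale _ _)).
by rewrite !qE path_scalerAr.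
Qed.

End BoundQuiverAlgebra.

(* Vertices are numbered from 0 to n - 1, and the arrow from i to j, for      *)
(* |i - j| = 1, is the pair (i, j).                                           *)
Definition B_arrow (n : nat) : finType :=
  {e : 'I_n * 'I_n | (nat_of_ord e.2 == e.1.+1) || (nat_of_ord e.1 == e.2.+1)}.

Definition B_quiver (n : nat) : quiver :=
  @Quiver 'I_n (B_arrow n) (fun a => (val a).1) (fun a => (val a).2).

Inductive B_relation (K : fieldType) (n : nat) :
  path_algebra K (B_quiver n) -> Prop :=
| B_length3 (p : qpath (B_quiver n)) :
    plength p = 3 -> B_relation (pbasis K p)
| B_noncycle (p : qpath (B_quiver n)) :
    plength p = 2 -> psrc p <> ptgt p -> B_relation (pbasis K p)
| B_cycles (v : 'I_n) (p q : qpath (B_quiver n)) :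
    plength p = 2 -> psrc p = v -> ptgt p = v ->
    plength q = 2 -> psrc q = v -> ptgt q = v ->
    B_relation (pbasis K p - pbasis K q)
| B_last (v : 'I_n) (p : qpath (B_quiver n)) :
    v.+1 = n -> plength p = 2 -> psrc p = v -> ptgt p = v ->
    B_relation (pbasis K p).

Definition B_algebra (K : fieldType) (n : nat) :=
  bound_quiver_algebra (@B_relation K n).

HB.instance Definition _ K n := GRing.PzRing.on (B_algebra K n).
HB.instance Definition _ K n := GRing.Lmodule.on (B_algebra K n).

(* An isomorphism of K-algebras; the target is only required to be a possibly *)
(* trivial ring since B_algebra K 0 = 0.                                      *)
Definition iso_to_B (K : fieldType) (A : falgType K) (n : nat) : Prop :=
  exists f : A -> B_algebra K n,
    [/\ linear f, monoid_morphism f & bijective f].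

(* Main.v *)
(* Write A = (+) e_i A with e_i A the projective cover P_i of L_i. A duality   *)
(* fixing the simples preserves composition multiplicities, and the classes   *)
(* of the P_i are distinct since they are unitriangular in the standard       *)
(* modules Delta_i; hence an injective P_i is isomorphic to its own dual and  *)
(* has the simple socle L_i. Since [P_n : L_n] = 1, an injective P_n would be  *)
(* simple and e_n central, so the non-injective projective is P_n.            *)
(* For i < n a Delta_k of largest index in the filtration of the kernel of    *)
(* P_i ->> Delta_i splits off from below; as the socle is simple, it occurs   *)
(* once, at the bottom, and soc Delta_k = L_i. So i |-> k is injective with    *)
(* k > i, i.e. k = i + 1. The pairing e_iAe_j x e_jAe_i -> soc P_i makes the   *)
(* Cartan matrix symmetric, which forces Delta_i = [L_i, L_(i-1)]: all Cartan  *)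
(* numbers are those of B_n, and the arrows can be rescaled one by one to     *)
(* satisfy its relations.                                                     *)
From HB Require Import structures.
Require Import Defs.
From mathcomp Require Import all_boot all_order all_algebra all_field.
From mathcomp Require Import generic_quotient finmap boolp monalg zify.

Set Implicit Arguments.
Unset Strict Implicit.
Unset Printing Implicit Defensive.

Import GRing.Theory.
Local Open Scope ring_scope.

(** * Modules, submodules and quotients *)

(** Cut [A] into right ideals [e i * A], copies of the projective covers [P i] of the simples [L i]
    ([basic_idempotents]). The simples are one-dimensional ([simple_line]), so the multiplicity of
    [L j] in [M] is the dimension of [M * e j], and the dimensions of the corners [e i * A * e j]
    are the Cartan numbers. These are shown to be those of [B_n], after which arrows are chosen.

    The duality keeps multiplicities ([dual_dimE]), and these distinguish the [P i], because the
    standard modules are unitriangular ([dimE_proj_inj]). An injective [P i] is dual to some [P j]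
    ([injective_proj_dual]), hence to itself, and so has the essential simple socle [L i]
    ([injective_proj_socle]). For n > 1 connectedness keeps the last projective from being injective
    ([last_not_injective]), so all others are; for n = 1 the algebra is the field, whose projective
    is injective, against the count.

    For [i] not last, the kernel of [P i] onto [Delta i] is nonzero and inherits a simple essential
    socle. So it contains a [Delta k] of the largest occurring index, occurring once, with socle
    [L i] ([uniform_filtered]). Distinct [i] have distinct [k > i], which forces k = i + 1
    ([proj_next]). Multiplication into the socle pairs opposite corners ([dim_corner_ge]), which
    settles [Delta_dim] and [corner_dim]. Rescaling arrows one by one gives the relations
    ([basic_iso_B]), and [iso_to_B_of_generators] compares [A] with [B_n] corner by corner. *)

Section ModuleTheory.
Variables (K : fieldType) (A : falgType K).
Implicit Types M N P S X : rmod A.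

Lemma rhom_eq M N (f g : rhom M N) : f =1 g -> f = g.
Proof.
case: f => f fP; case: g => g gP /= /lfunP fg.
by move: gP; rewrite -fg => gP; congr RHom; apply: Prop_irrelevance.
Qed.

Lemma rcompE M N P (g : rhom N P) (f : rhom M N) m : rcomp g f m = g (f m).
Proof. by rewrite comp_lfunE. Qed.

Lemma ridE M m : rid M m = m.
Proof. by rewrite /= id_lfunE. Qed.

Definition actf M (a : A) : 'End(M) := linfun (fun m : M => ract m a).

Lemma actfE M a (m : M) : actf M a m = ract m a.
Proof.
pose h := GRing.isLinear.Build K M M *:%R (fun m : M => ract m a) (@ract_linearl K A M a).
pose L : {linear M -> M} := HB.pack (fun m : M => ract m a) h.
exact: (lfunE L).
Qed.

Lemma ract0l M a : ract (0 : M) a = 0.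
Proof. by rewrite -actfE linear0. Qed.

Lemma ractDl M (m m' : M) a : ract (m + m') a = ract m a + ract m' a.
Proof. by rewrite -!actfE linearD. Qed.

Lemma ractNl M (m : M) a : ract (- m) a = - ract m a.
Proof. by rewrite -!actfE linearN. Qed.

Lemma ractBl M (m m' : M) a : ract (m - m') a = ract m a - ract m' a.
Proof. by rewrite ractDl ractNl. Qed.

Lemma ractZl M c (m : M) a : ract (c *: m) a = c *: ract m a.
Proof. by rewrite -!actfE linearZ. Qed.

Definition actm M (m : M) : 'Hom(A, M) := linfun (fun a : A => ract m a).

Lemma actmE M (m : M) a : actm m a = ract m a.
Proof.
pose h := GRing.isLinear.Build K A M *:%R (fun a : A => ract m a) (@ract_linearr K A M m).
pose L : {linear A -> M} := HB.pack (fun a : A => ract m a) h.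
exact: (lfunE L).
Qed.

Lemma ract0r M (m : M) : ract m 0 = 0.
Proof. by rewrite -actmE linear0. Qed.

Lemma ractDr M (m : M) a b : ract m (a + b) = ract m a + ract m b.
Proof. by rewrite -!actmE linearD. Qed.

Lemma ractBr M (m : M) a b : ract m (a - b) = ract m a - ract m b.
Proof. by rewrite -!actmE linearB. Qed.

Lemma ractZr M (m : M) c a : ract m (c *: a) = c *: ract m a.
Proof. by rewrite -!actmE linearZ. Qed.

Lemma ract_sumr M (m : M) I (r : seq I) (Q : pred I) (F : I -> A) :
  ract m (\sum_(i <- r | Q i) F i) = \sum_(i <- r | Q i) ract m (F i).
Proof.
by rewrite -actmE linear_sum; apply: eq_bigr => i _; exact: actmE.
Qed.

Lemma elem_hom_subproof M (m : M) (a b : regular_rmod A) :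
  actm m (ract a b) = ract (actm m a) b.
Proof.
apply: etrans (actmE m (a * b)) _; rewrite ractM.
congr (ract _ b); exact: esym (actmE m a).
Qed.

Definition elem_hom M (m : M) : rhom (regular_rmod A) M :=
  RHom (elem_hom_subproof m).

Lemma elem_homE M (m : M) a : elem_hom m a = ract m a.
Proof. exact: actmE. Qed.

Lemma rzero_subproof M N (m : M) a :
  (0 : 'Hom(M, N)) (ract m a) = ract ((0 : 'Hom(M, N)) m) a.
Proof. by rewrite !zero_lfunE ract0l. Qed.

Definition rzero M N : rhom M N := RHom (@rzero_subproof M N).

Lemma rzeroE M N m : rzero M N m = 0.
Proof. by rewrite /= zero_lfunE. Qed.

Section Submodule.
Variables (M : rmod A) (U : {vspace M}) (hU : submodule U).

Definition sub_act (m : subvs_of U) a : subvs_of U := vsproj U (ract (vsval m) a).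

Lemma sub_actE m a : vsval (sub_act m a) = ract (vsval m) a.
Proof. by rewrite vsprojK // hU // subvsP. Qed.

Lemma sub_act_linearl a : linear (fun m => sub_act m a).
Proof.
by move=> c m m'; rewrite /sub_act linearP /= ractDl ractZl linearP.
Qed.

Lemma sub_act_linearr m : linear (sub_act m).
Proof. by move=> c a b; rewrite /sub_act ractDr ractZr linearP. Qed.

Lemma sub_act1 m : sub_act m 1 = m.
Proof. by rewrite /sub_act ract1 vsvalK. Qed.

Lemma sub_actM m a b : sub_act m (a * b) = sub_act (sub_act m a) b.
Proof. by rewrite {2}/sub_act sub_actE -ractM. Qed.

Definition sub_rmod : rmod A :=
  RMod sub_act_linearl sub_act_linearr sub_act1 sub_actM.

Lemma sub_inj_subproof (m : sub_rmod) a :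
  (linfun (@vsval _ _ U) : 'Hom(sub_rmod, M)) (ract m a) =
  ract ((linfun (@vsval _ _ U) : 'Hom(sub_rmod, M)) m) a.
Proof. by rewrite !lfunE /= sub_actE. Qed.

Definition sub_inj : rhom sub_rmod M := RHom sub_inj_subproof.

Lemma sub_injE m : sub_inj m = vsval m.
Proof. by rewrite /= lfunE. Qed.

Lemma sub_inj_inj : injective sub_inj.
Proof. by move=> m m'; rewrite !sub_injE; exact: subvs_inj. Qed.

Lemma limg_sub_inj : limg sub_inj = U.
Proof.
apply/vspaceP => m; apply/idP/idP => [/memv_imgP[x _ ->]|mU].
  by rewrite [X in X \in _]sub_injE subvsP.
by rewrite -(vsprojK mU) -sub_injE memv_img ?memvf.
Qed.

End Submodule.

Section Quotient.
Variables (M : rmod A) (U : {vspace M}) (hU : submodule U).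

(** The quotient is carried by a linear complement of [U]: act in [M], then project along [U]. *)
Let W := (U^C)%VS.
Let pr : 'End(M) := daddv_pi W U.

Let WU0 : (W :&: U = 0)%VS. Proof. by rewrite capvC capv_compl. Qed.

Let pr_cong m : m - pr m \in U.
Proof.
have: m \in (W + U)%VS by rewrite addvC addv_complf memvf.
move/(daddv_pi_add WU0) => {1}<-.
by rewrite addrAC subrr add0r memv_pi.
Qed.

Let pr_ker m : m \in U -> pr m = 0.
Proof.
move=> mU; apply/eqP; rewrite -memv0 -WU0 memv_cap memv_pi.
by rewrite -[pr m](subKr m) memvB // pr_cong.
Qed.

Definition quo_act (m : subvs_of W) a : subvs_of W :=
  vsproj W (pr (ract (vsval m) a)).

Let quo_actE m a : vsval (quo_act m a) = pr (ract (vsval m) a).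
Proof. by rewrite vsprojK ?memv_pi. Qed.

Let pr_id m : m \in W -> pr m = m. Proof. exact: daddv_pi_id. Qed.

Let pr_act m a : pr (ract (pr m) a) = pr (ract m a).
Proof.
apply/eqP; rewrite -subr_eq0 -linearB; apply/eqP/pr_ker.
by rewrite -ractBl hU // -memvN opprB.
Qed.

Lemma quo_act_linearl a : linear (fun m => quo_act m a).
Proof.
by move=> c m m'; rewrite /quo_act linearP /= ractDl ractZl !linearP.
Qed.

Lemma quo_act_linearr m : linear (quo_act m).
Proof. by move=> c a b; rewrite /quo_act ractDr ractZr !linearP. Qed.

Lemma quo_act1 m : quo_act m 1 = m.
Proof. by rewrite /quo_act ract1 pr_id ?subvsP // vsvalK. Qed.

Lemma quo_actM m a b : quo_act m (a * b) = quo_act (quo_act m a) b.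
Proof. by rewrite {2}/quo_act quo_actE pr_act -ractM. Qed.

Definition quo_rmod : rmod A :=
  RMod quo_act_linearl quo_act_linearr quo_act1 quo_actM.

Let quo_fun : 'Hom(M, quo_rmod) := (linfun (vsproj W) \o pr)%VF.

Let quo_funE m : quo_fun m = vsproj W (pr m).
Proof. by rewrite comp_lfunE lfunE. Qed.

Lemma quo_proj_subproof (m : M) a : quo_fun (ract m a) = ract (quo_fun m) a.
Proof.
by rewrite !quo_funE /= /quo_act vsprojK ?memv_pi // pr_act.
Qed.

Definition quo_proj : rhom M quo_rmod := RHom quo_proj_subproof.

Lemma quo_proj_surj : surjective_rhom quo_proj.
Proof.
apply/vspaceP => y; rewrite memvf; apply/memv_imgP; exists (vsval y); rewrite ?memvf //=.
by rewrite quo_funE pr_id ?subvsP // vsvalK.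
Qed.

Lemma lker_quo_proj : lker quo_proj = U.
Proof.
apply/vspaceP => m; rewrite memv_ker /= quo_funE.
apply/eqP/idP => [/(congr1 val)/= e|/pr_ker->]; last by rewrite linear0.
have := pr_cong m; rewrite vsprojK ?memv_pi // in e.
by rewrite e subr0.
Qed.

End Quotient.

Lemma submodule_lker M N (f : rhom M N) : submodule (lker f).
Proof. by move=> m a; rewrite !memv_ker rfunP => /eqP->; rewrite ract0l. Qed.

Lemma submodule_img M N (f : rhom M N) (U : {vspace M}) :
  submodule U -> submodule (f @: U)%VS.
Proof.
by move=> hU _ a /memv_imgP[m mU ->]; rewrite -rfunP memv_img ?hU.
Qed.

Lemma submodule_full M : submodule (fullv : {vspace M}).
Proof. by move=> *; rewrite memvf. Qed.

Lemma submodule_preim M N (f : rhom M N) (V : {vspace N}) :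
  submodule V -> submodule (f @^-1: V)%VS.
Proof. by move=> hV m a; rewrite -!memv_preim rfunP; apply: hV. Qed.

Lemma submodule_elem M (m : M) : submodule (limg (elem_hom m)).
Proof. exact/submodule_img/submodule_full. Qed.

Lemma mem_elem M (m : M) : m \in limg (elem_hom m).
Proof. by apply/memv_imgP; exists 1; rewrite ?memvf // [RHS]elem_homE ract1. Qed.

Lemma surjP M N (f : rhom M N) :
  surjective_rhom f <-> forall y, exists x, f x = y.
Proof.
split=> [e y|h]; last first.
  by apply/vspaceP => y; rewrite memvf; have [x <-] := h y; rewrite memv_img ?memvf.
have yf : y \in limg f by rewrite e memvf.
by case/memv_imgP: yf => x _ ->; exists x.
Qed.

Lemma bij_surj M N (f : rhom M N) : bijective f -> surjective_rhom f.
Proof. by case=> g _ gK; apply/surjP => y; exists (g y). Qed.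

Lemma inj_surj_bij M N (f : rhom M N) :
  injective f -> surjective_rhom f -> bijective f.
Proof.
move=> /lker0P k0 e; exists (f^-1)%VF; first exact: lker0_lfunK.
by move=> y; rewrite limg_lfunVK // e memvf.
Qed.

Lemma lift_mono X M N (g : rhom M N) (f : rhom X N) :
  injective g -> (limg f <= limg g)%VS -> exists h : rhom X M, rcomp g h = f.
Proof.
move=> /lker0P k0 s.
have gV y : y \in limg f -> g ((g^-1)%VF y) = y.
  by move=> yf; rewrite limg_lfunVK // (subvP s).
have hP (x : X) a : (g^-1 \o f)%VF (ract x a) = ract ((g^-1 \o f)%VF x) a.
  move/lker0P: k0 => gi.
  by apply: gi; rewrite rfunP !comp_lfunE !gV ?memv_img ?memvf // rfunP.
exists (RHom hP); apply: rhom_eq => x.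
by rewrite rcompE /= comp_lfunE gV ?memv_img ?memvf.
Qed.

Lemma factor_surj M N X (g : rhom M N) (f : rhom M X) :
  surjective_rhom g -> (lker g <= lker f)%VS ->
  exists h : rhom N X, rcomp h g = f.
Proof.
move=> e s.
have gV y : g ((g^-1)%VF y) = y by rewrite limg_lfunVK // e memvf.
have fE m m' : g m = g m' -> f m = f m'.
  move=> E; apply/eqP; rewrite -subr_eq0 -linearB -memv_ker (subvP s) //.
  by rewrite memv_ker linearB /= E subrr.
have hP (x : N) a : (f \o g^-1)%VF (ract x a) = ract ((f \o g^-1)%VF x) a.
  by rewrite !comp_lfunE -rfunP; apply: fE; rewrite rfunP !gV.
by exists (RHom hP); apply: rhom_eq => x; rewrite rcompE /= comp_lfunE; apply: fE.
Qed.

Lemma bij_inverse M N (f : rhom M N) :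
  bijective f -> exists g : rhom N M, rcomp f g = rid N /\ rcomp g f = rid M.
Proof.
move=> bf; have fi := bij_inj bf; have fs := bij_surj bf.
have [g fg] : exists g : rhom N M, rcomp f g = rid N.
  by apply: lift_mono; rewrite // fs subvf.
exists g; split=> //; apply: rhom_eq => m; apply: fi.
have := congr1 (fun h : rhom N N => h (f m)) fg.
by rewrite /= !rcompE !ridE.
Qed.

Lemma rcomp_bij M N P (g : rhom N P) (f : rhom M N) :
  bijective g -> bijective f -> bijective (rcomp g f).
Proof.
by move=> bg bf; apply: (eq_bij (bij_comp bg bf)) => m; rewrite /= rcompE.
Qed.

Lemma iso_sym M N : rmod_iso M N -> rmod_iso N M.
Proof.
case=> f bf; have [g [fg gf]] := bij_inverse bf; exists g; exists f => m.
  by rewrite -rcompE fg ridE.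
by rewrite -rcompE gf ridE.
Qed.

Lemma iso_trans M N P : rmod_iso M N -> rmod_iso N P -> rmod_iso M P.
Proof. by case=> f bf [g bg]; exists (rcomp g f); apply: rcomp_bij. Qed.

Lemma fullv0P M : (fullv : {vspace M}) = 0%VS <-> forall m : M, m = 0.
Proof.
split=> [e m|h]; first by apply/eqP; rewrite -memv0 -e memvf.
by apply/vspaceP => m; rewrite (h m) !mem0v.
Qed.

Lemma not_fullv0 M : (fullv : {vspace M}) <> 0%VS -> exists m : M, m != 0.
Proof.
move=> nz; apply/not_existsP => h; apply: nz; apply/fullv0P => m.
by apply/eqP/negPn/negP => /h.
Qed.

Lemma simple_submodule M (U : {vspace M}) : submodule U -> U <> 0%VS ->
  exists S (f : rhom S M), [/\ simple_rmod S, injective f & (limg f <= U)%VS].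
Proof.
have [k] := ubnP (\dim U); elim: k U => // k IH U ltk hU nU.
have [[V [hV VU nV0 nVU]]|h] := EM (exists V : {vspace M},
  [/\ submodule V, (V <= U)%VS, V <> 0%VS & V <> U]).
  have ltVU : (\dim V < \dim U)%N.
    by rewrite ltn_neqAle dimvS // andbT dimv_leqif_eq //; apply/eqP.
  have [|S [f [Ss fi fV]]] := IH V _ hV nV0; first exact: leq_trans ltVU _.
  by exists S, f; split=> //; exact: subv_trans VU.
exists (sub_rmod hU), (sub_inj hU); rewrite limg_sub_inj; split=> //; last first.
  exact: sub_inj_inj.
split=> [e|V hV].
  apply: nU; rewrite -(limg_sub_inj hU) e; exact: limg0.
have [->|/eqP nV0] := eqVneq V 0%VS; [by left|right].
have ki : lker (sub_inj hU) == 0%VS by apply/lker0P/sub_inj_inj.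
apply/eqP; rewrite -(eq_limg_ker0 _ _ ki) limg_sub_inj; apply/eqP.
apply: contrapT => ne; apply: h; exists (sub_inj hU @: V)%VS; split=> //.
- exact: submodule_img.
- by apply: subv_trans (limgS _ (subvf V)) _; rewrite limg_sub_inj.
- by move/eqP; rewrite -(limg0 (sub_inj hU)) eq_limg_ker0 // => /eqP.
Qed.

Lemma quotient_exists M (U : {vspace M}) : submodule U ->
  exists N (g : rhom M N), surjective_rhom g /\ lker g = U.
Proof.
move=> hU; exists (quo_rmod hU), (quo_proj hU).
by split; [exact: quo_proj_surj|exact: lker_quo_proj].
Qed.

Lemma simple_quotient M : (fullv : {vspace M}) <> 0%VS ->
  exists S (f : rhom M S), simple_rmod S /\ surjective_rhom f.
Proof.
have [k] := ubnP (\dim (fullv : {vspace M})).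
elim: k M => // k IH M ltk nM.
have [Ms|nMs] := EM (simple_rmod M).
  by exists M, (rid M); split=> //; apply/surjP => y; exists y; rewrite ridE.
have [V [hV nV0 nVf]] : exists V : {vspace M},
    [/\ submodule V, V <> 0%VS & V <> fullv].
  apply/not_existsP => h; apply: nMs; split=> // V hV.
  have [->|/eqP V0] := eqVneq V 0%VS; [by left|right].
  by apply: contrapT => Vf; apply: (h V).
have [N [g [gs gk]]] := quotient_exists hV.
have dimN : (\dim V + \dim (fullv : {vspace N}) = \dim (fullv : {vspace M}))%N.
  by rewrite -gs -(limg_ker_dim g fullv) capfv gk.
have Vgt0 : (0 < \dim V)%N by rewrite lt0n dimv_eq0; apply/eqP.
have [||S [f [Ss fs]]] := IH N.
- by rewrite -ltnS (leq_trans _ ltk) // ltnS -dimN -[X in (X < _)%N]add0n ltn_add2r.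
- move=> N0; apply: nVf; apply/eqP; rewrite eqEdim subvf -dimN N0 dimv0 addn0 //=.
exists S, (rcomp f g); split=> //; apply/surjP => y.
have /surjP/(_ y)[x <-] := fs; have /surjP/(_ x)[m <-] := gs.
by exists m; rewrite rcompE.
Qed.

Lemma to_simple_surj M S (f : rhom M S) (m : M) :
  simple_rmod S -> f m != 0 -> surjective_rhom f.
Proof.
move=> [_ Ss] fm; have [||//] := Ss (limg f).
  exact/submodule_img/submodule_full.
move=> e; move: fm; rewrite -memv0 -e memv_img ?memvf //.
Qed.

Lemma from_simple_inj M S (f : rhom S M) (m : S) :
  simple_rmod S -> f m != 0 -> injective f.
Proof.
move=> [_ Ss] fm; apply/lker0P; have [|->//|e] := Ss (lker f).
  exact: submodule_lker.
by move: fm; rewrite -memv_ker e memvf.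
Qed.

(** [N] is the direct sum of the image of [f] and the kernel of [r]; the image is nonzero, so the
    kernel vanishes. *)
Lemma split_indecomposable M N (f : rhom M N) (r : rhom N M) :
  (fullv : {vspace M}) <> 0%VS -> indecomposable N ->
  bijective (rcomp r f) -> bijective f.
Proof.
move=> nM [_ Ni] b.
have fi : injective f.
  by move=> x y e; apply: (bij_inj b); rewrite !rcompE e.
apply: inj_surj_bij => //.
have [|||| e|e] := Ni (limg f) (lker r).
- exact/submodule_img/submodule_full.
- exact: submodule_lker.
- apply/vspaceP => y; rewrite memvf; apply/memv_addP.
  have /surjP/(_ (r y))[x e] := bij_surj b.
  exists (f x); rewrite ?memv_img ?memvf //; exists (y - f x); last by rewrite addrC subrK.
  by rewrite memv_ker linearB /= -rcompE e subrr.
- apply/eqP; rewrite -subv0; apply/subvP => y /memv_capP[/memv_imgP[x _ ->]].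
  rewrite memv_ker -[r _]rcompE => /eqP e; rewrite memv0.
  suff -> : x = 0 by rewrite linear0.
  by apply: (bij_inj b); rewrite e linear0.
- case: nM; apply/fullv0P => m; apply: fi; rewrite linear0; apply/eqP.
  by rewrite -memv0 -e memv_img ?memvf.
- apply/surjP => y; have /surjP/(_ (r y))[x E] := bij_surj b; exists x.
  by apply/eqP; rewrite -subr_eq0 -memv0 -e memv_ker linearB /= -rcompE E subrr.
Qed.

Definition superfluous_ker P L (p : rhom P L) : Prop :=
  forall U : {vspace P}, submodule U -> (U + lker p)%VS = fullv -> U = fullv.

End ModuleTheory.

(** * Multiplicities and duality *)

Section Multiplicities.
Variables (K : fieldType) (A : falgType K).
Implicit Types M N P S X : rmod A.

(* For a primitive idempotent e, this is the multiplicity in M of the top of eA. *)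
Definition dimE M (e : A) : nat := \dim (limg (actf M e)).

Lemma img_actf M N (f : rhom M N) (e : A) :
  (f @: limg (actf M e) = actf N e @: limg f)%VS.
Proof.
rewrite -!limg_comp; congr (lfun_img _ _); apply/lfunP => m.
by rewrite !comp_lfunE !actfE rfunP.
Qed.

(** Only an inclusion is asked in the middle: this is all that is used of a dualized exact
    sequence. *)
Lemma dimE_exact_ge M N P (f : rhom M N) (g : rhom N P) (e : A) :
  injective f -> (limg f <= lker g)%VS -> surjective_rhom g ->
  (dimE M e + dimE P e <= dimE N e)%N.
Proof.
move=> fi fg gs; rewrite /dimE -(limg_ker_dim g (limg (actf N e))).
rewrite img_actf gs leq_add2r -(limg_dim_eq (f := f)); last first.
  by have /lker0P/eqP-> := fi; rewrite capv0.
rewrite dimvS // subv_cap img_actf limgS ?subvf //=.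
apply: subv_trans fg; rewrite -img_actf limgS ?subvf //.
Qed.

Lemma dimE_exact M N P (f : rhom M N) (g : rhom N P) (e : A) :
  e * e = e -> short_exact f g -> dimE N e = (dimE M e + dimE P e)%N.
Proof.
move=> ee [fi fg gs]; rewrite /dimE -(limg_ker_dim g (limg (actf N e))).
rewrite img_actf gs -(limg_dim_eq (f := f)); last first.
  by have /lker0P/eqP-> := fi; rewrite capv0.
congr (\dim _ + _)%N; apply/eqP; rewrite eqEsubv subv_cap -fg.
rewrite (limgS _ (subvf _)) andbT; apply/andP; split; last first.
  by rewrite img_actf limgS ?subvf.
apply/subvP => n /memv_capP[/memv_imgP[n' _ ->]]; rewrite actfE.
case/memv_imgP => m _ En.
have -> : ract n' e = f (ract m e) by rewrite rfunP -En -ractM ee.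
by rewrite memv_img // -actfE memv_img ?memvf.
Qed.

Lemma dimE_inj M N (f : rhom M N) (e : A) : injective f -> (dimE M e <= dimE N e)%N.
Proof.
move=> /lker0P/eqP k0; rewrite /dimE -(limg_dim_eq (f := f)) ?k0 ?capv0 //.
by rewrite dimvS // img_actf limgS ?subvf.
Qed.

Lemma dimE_iso M N (e : A) : rmod_iso M N -> dimE M e = dimE N e.
Proof.
move=> iso; apply/eqP; rewrite eqn_leq.
case: (iso) => f /bij_inj fi; case: (iso_sym iso) => g /bij_inj gi.
by rewrite (dimE_inj _ fi) (dimE_inj _ gi).
Qed.

Lemma dimE_eq0 M (e : A) : (dimE M e == 0%N) <-> forall m : M, ract m e = 0.
Proof.
rewrite /dimE dimv_eq0; split=> [/eqP h m|h].
  by apply/eqP; rewrite -memv0 -h -actfE memv_img ?memvf.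
rewrite -subv0; apply/subvP => _ /memv_imgP[m _ ->].
by rewrite actfE h mem0v.
Qed.

Lemma dimE_zero M (e : A) : (fullv : {vspace M}) = 0%VS -> dimE M e = 0%N.
Proof. by move=> /fullv0P h; apply/eqP/dimE_eq0 => m; rewrite (h m) ract0l. Qed.

End Multiplicities.

(** * Effect of a duality on maps and multiplicities *)

Section Duality.
Variables (K : fieldType) (A : falgType K) (D : contrafunctor A).
Variable eta : forall M : rmod A, rhom M (D (D M)).
Hypothesis eta_bij : forall M, bijective (eta M).
Hypothesis eta_nat : forall M N (f : rhom M N),
  rcomp (eta N) f = rcomp (cmap D (cmap D f)) (eta M).
Implicit Types M N P S X : rmod A.

Lemma eta_natE M N (f : rhom M N) m : eta N (f m) = cmap D (cmap D f) (eta M m).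
Proof. by have := congr1 (fun h : rhom _ _ => h m) (eta_nat f); rewrite /= !rcompE. Qed.

Lemma cmap_compE M N P (g : rhom N P) (f : rhom M N) x :
  cmap D (rcomp g f) x = cmap D f (cmap D g x).
Proof. by rewrite cmap_comp rcompE. Qed.

Lemma duality_faithful M N (f g : rhom M N) : cmap D f = cmap D g -> f = g.
Proof.
by move=> e; apply: rhom_eq => m; apply: (bij_inj (eta_bij N)); rewrite !eta_natE e.
Qed.

Lemma DD_inj M N (f : rhom M N) : injective f -> injective (cmap D (cmap D f)).
Proof.
move=> fi x y; have [v _ vK] := eta_bij M; rewrite -(vK x) -(vK y) -!eta_natE.
by move=> /(bij_inj (eta_bij N))/fi ->.
Qed.

Lemma DD_surj M N (f : rhom M N) :
  surjective_rhom f -> surjective_rhom (cmap D (cmap D f)).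
Proof.
move=> /surjP fs; apply/surjP => y; have [v _ vK] := eta_bij N.
by have [x e] := fs (v y); exists (eta M x); rewrite -eta_natE e vK.
Qed.

(** Let [q] be the cokernel of [D f]. After composition with the injective [D (D f)], the maps [D q]
    and [D 0] agree, since [q] and 0 both kill the image of [D f]; faithfulness gives [q = 0].
    Comparing with [D 0] avoids any appeal to additivity of [D]. *)
Lemma dual_inj M N (f : rhom M N) : injective f -> surjective_rhom (cmap D f).
Proof.
move=> /DD_inj fi.
have [C [q [qs qk]]] := quotient_exists (submodule_img (f := cmap D f) (@submodule_full _ _ _)).
have q0 : q = rzero _ _.
  apply: duality_faithful; apply: rhom_eq => x; apply: fi.
  rewrite -!cmap_compE; congr (cmap D _ x); apply: rhom_eq => y.
  rewrite !rcompE rzeroE; apply/eqP.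
  by rewrite -memv_ker qk memv_img ?memvf.
apply/vspaceP => y; rewrite memvf -qk memv_ker.
by rewrite q0 /= zero_lfunE eqxx.
Qed.

(** The same argument with the inclusion of the kernel of [D f], cancelling the surjective
    [D (D f)]. *)
Lemma dual_surj M N (f : rhom M N) : surjective_rhom f -> injective (cmap D f).
Proof.
move=> /DD_surj/surjP fs.
pose k := sub_inj (submodule_lker (f := cmap D f)).
have k0 : k = rzero _ _.
  apply: duality_faithful; apply: rhom_eq => y; have [x <-] := fs y.
  rewrite -!cmap_compE; congr (cmap D _ x); apply: rhom_eq => z.
  rewrite !rcompE rzeroE linear0; apply/eqP; rewrite -memv_ker.
  by rewrite -[in X in _ \in X](limg_sub_inj (submodule_lker (f := cmap D f))) memv_img ?memvf.
apply/lker0P; rewrite -(limg_sub_inj (submodule_lker (f := cmap D f))) -/k k0.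
by rewrite /= lim0g.
Qed.

Lemma dual_bij M N (f : rhom M N) : bijective f -> bijective (cmap D f).
Proof.
move=> b; apply: inj_surj_bij; first exact/dual_surj/bij_surj.
exact/dual_inj/bij_inj.
Qed.

(** The zero map from [M = 0] to [D M] is injective, so its dual maps [D (D M)], a copy of [M], onto
    [D M]. *)
Lemma dual0 M : (fullv : {vspace M}) = 0%VS -> (fullv : {vspace D M}) = 0%VS.
Proof.
move=> /fullv0P M0.
have i0 : injective (rzero M (D M)) by move=> x y _; rewrite (M0 x) (M0 y).
have /surjP s := dual_inj i0.
apply/fullv0P => y; have [x <-] := s y.
have [v _ vK] := eta_bij M.
by rewrite -(vK x) (M0 (v x)) !linear0.
Qed.

(** The zero map factors through the zero module, whose dual is zero. *)
Lemma dual_zero M N : cmap D (rzero M N) = rzero (D N) (D M).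
Proof.
have hZ : submodule (0%VS : {vspace M}).
  by move=> m a; rewrite !memv0 => /eqP->; rewrite ract0l.
have Z0 : (fullv : {vspace sub_rmod hZ}) = 0%VS.
  by apply/fullv0P => z; apply: val_inj; apply/eqP; rewrite /= -memv0 subvsP.
have -> : rzero M N = rcomp (rzero (sub_rmod hZ) N) (rzero M (sub_rmod hZ)).
  by apply: rhom_eq => m; rewrite rcompE !rzeroE.
apply: rhom_eq => y; rewrite cmap_compE rzeroE.
by have /fullv0P/(_ (cmap D (rzero (sub_rmod hZ) N) y)) -> := dual0 Z0; rewrite linear0.
Qed.

Lemma dual_nonzero M : (fullv : {vspace M}) <> 0%VS -> (fullv : {vspace D M}) <> 0%VS.
Proof.
move=> nM /dual0/fullv0P h; apply: nM; apply/fullv0P => m.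
by apply: (bij_inj (eta_bij M)); rewrite (h (eta M m)) linear0.
Qed.

Hypothesis D_simple : forall S, simple_rmod S -> rmod_iso (D S) S.

(* Only half of the exactness of D is used: applying this to both M and D M   *)
(* gives the equality.                                                        *)
Lemma dual_dimE_ge M (e : A) : e * e = e -> (dimE M e <= dimE (D M) e)%N.
Proof.
move=> ee; have [k] := ubnP (\dim (fullv : {vspace M})).
elim: k M => // k IH M ltk.
have [/eqP M0|/eqP nM] := boolP ((fullv : {vspace M}) == 0%VS).
  by rewrite (dimE_zero _ M0).
have [S [f [Ss fi _]]] := simple_submodule (@submodule_full _ _ M) nM.
have [Q [g [gs gk]]] := quotient_exists (submodule_img (f := f) (@submodule_full _ _ _)).
rewrite (dimE_exact ee (And3 fi (esym gk) gs)).
apply: leq_trans (dimE_exact_ge (f := cmap D g) (g := cmap D f) e _ _ _).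
- rewrite addnC leq_add //; last by rewrite (dimE_iso e (D_simple Ss)).
  apply: IH; rewrite -ltnS (leq_trans _ ltk) // ltnS.
  rewrite -[X in (_ < X)%N](limg_ker_dim g fullv) gs capfv gk.
  rewrite -[X in (X < _)%N]add0n ltn_add2r lt0n dimv_eq0.
  apply/eqP => e0; case: Ss => + _; apply; apply/fullv0P => s.
  apply: fi; rewrite linear0; apply/eqP.
  by rewrite -memv0 -e0 memv_img ?memvf.
- exact: dual_surj.
- apply/subvP => _ /memv_imgP[x _ ->]; rewrite memv_ker -cmap_compE.
  have -> : rcomp g f = rzero _ _.
    apply: rhom_eq => s; rewrite rcompE rzeroE; apply/eqP.
    by rewrite -memv_ker gk memv_img ?memvf.
  by rewrite dual_zero rzeroE.
- exact: dual_inj.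
Qed.

Lemma dual_dimE M (e : A) : e * e = e -> dimE (D M) e = dimE M e.
Proof.
move=> ee; apply/eqP; rewrite eqn_leq dual_dimE_ge // andbT.
apply: leq_trans (dual_dimE_ge (D M) ee) _.
have iso : rmod_iso M (D (D M)) by exists (eta M).
by rewrite (dimE_iso e iso).
Qed.

(** An essential epimorphism dualizes to an essential monomorphism. The image of [D h], pulled back
    to [P] along [eta], fills [P] together with [lker p]; superfluity makes [D h] surjective, hence
    [h] injective. *)
Lemma dual_essential P S (p : rhom P S) : surjective_rhom p ->
  superfluous_ker p -> forall X (h : rhom (D P) X), injective (rcomp h (cmap D p)) -> injective h.
Proof.
move=> /surjP ps small X h /dual_inj/surjP s.
suff : surjective_rhom (cmap D h).
  move=> /dual_surj; set h2 := cmap D (cmap D h) => h2i x y e.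
  apply: (bij_inj (eta_bij (D P))).
  by apply: h2i; rewrite -!eta_natE e.
have sU : submodule (limg (cmap D h)) by apply/submodule_img/submodule_full.
have sV := submodule_preim (f := eta P) sU.
have /small-/(_ sV) : ((eta P @^-1: limg (cmap D h)) + lker p)%VS = fullv.
  apply/vspaceP => x; rewrite memvf; apply/memv_addP.
  have [y Ey] := s (eta S (p x)).
  have [v _ vK] := eta_bij P.
  exists (v (cmap D h y)).
    by rewrite -memv_preim [X in X \in _]vK memv_img ?memvf.
  exists (x - v (cmap D h y)); last by rewrite addrC subrK.
  rewrite memv_ker linearB subr_eq0; apply/eqP.
  by apply: (bij_inj (eta_bij S)); rewrite -Ey cmap_compE [RHS]eta_natE vK.
move=> e; apply/vspaceP => y; rewrite memvf.
have [v _ vK] := eta_bij P.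
have : eta P (v y) \in limg (cmap D h) by rewrite memv_preim e memvf.
by rewrite vK.
Qed.

End Duality.

(** * Projective covers *)

Section Covers.
Variables (K : fieldType) (A : falgType K).
Implicit Types M N P S X : rmod A.

(** A submodule outside the kernel maps onto the simple [L], so it is everything by superfluity:
    [lker p] is the largest proper submodule. *)
Lemma submodule_cover P L (p : rhom P L) (U : {vspace P}) : simple_rmod L ->
  superfluous_ker p -> submodule U -> U <> fullv -> (U <= lker p)%VS.
Proof.
move=> [_ Ls] small hU nU; have [|/eqP e|e] := Ls (p @: U)%VS.
- exact: submodule_img.
- by rewrite lkerE.
case: nU; apply: small => //; apply/vspaceP => x; rewrite memvf; apply/memv_addP.
have /memv_imgP[u uU e1] : p x \in (p @: U)%VS by rewrite e memvf.
exists u => //; exists (x - u); last by rewrite addrC subrK.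
by rewrite memv_ker linearB /= e1 subrr.
Qed.

(** [lker f] is proper, hence inside [lker p]. If [f] mapped [lker p] onto [S], then [P] would be
    [lker f + lker p], which is [lker p]. *)
Lemma cover_ker P L (p : rhom P L) S (f : rhom P S) x : simple_rmod L ->
  surjective_rhom p -> superfluous_ker p -> simple_rmod S -> f x != 0 ->
  lker f = lker p.
Proof.
move=> Ls ps small Ss fx.
have sf := submodule_lker (f := f).
have fle : (lker f <= lker p)%VS.
  apply: submodule_cover => // e.
  by move: fx; rewrite -memv_ker e memvf.
apply/eqP; rewrite eqEsubv fle /= lkerE.
have [|-> //|e] := Ss.2 (f @: lker p)%VS; first exact/submodule_img/submodule_lker.
case: Ls => /not_fullv0[y +] _.
have /surjP/(_ y)[z <-] := ps.
have /memv_imgP[w wp E] : f z \in (f @: lker p)%VS by rewrite e memvf.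
case/negP; rewrite -memv_ker -[z](subrK w) memvD // (subvP fle) //.
by rewrite memv_ker linearB /= E subrr.
Qed.

Lemma cover_factor P L (p : rhom P L) S (f : rhom P S) x : simple_rmod L ->
  surjective_rhom p -> superfluous_ker p -> simple_rmod S -> f x != 0 ->
  exists h : rhom L S, rcomp h p = f.
Proof.
by move=> Ls ps small Ss fx; apply: factor_surj; rewrite // (cover_ker Ls ps small Ss fx).
Qed.

Lemma simple_hom_bij L S (h : rhom L S) x :
  simple_rmod L -> simple_rmod S -> h x != 0 -> bijective h.
Proof.
move=> Ls Ss hx; apply: inj_surj_bij.
  exact: (from_simple_inj Ls hx).
exact: (to_simple_surj Ss hx).
Qed.

Lemma cover_iso P L (p : rhom P L) S (f : rhom P S) x : simple_rmod L ->
  surjective_rhom p -> superfluous_ker p -> simple_rmod S -> f x != 0 ->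
  rmod_iso L S.
Proof.
move=> Ls ps small Ss fx.
have [h E] := cover_factor Ls ps small Ss fx.
exists h; apply: (@simple_hom_bij _ _ _ (p x)) => //.
by rewrite -rcompE E.
Qed.

Lemma cover_indecomposable P L (p : rhom P L) : simple_rmod L ->
  surjective_rhom p -> superfluous_ker p -> indecomposable P.
Proof.
move=> Ls ps small.
have nk : lker p <> fullv.
  move=> e; case: Ls => + _; apply; rewrite -ps; apply/eqP.
  by rewrite -lkerE e subvv.
split=> [e|U V hU hV UV UV0].
  by apply: nk; apply/eqP; rewrite eqEsubv subvf e sub0v.
have [eU|/eqP nU] := eqVneq U fullv.
  by right; rewrite -UV0 eU capfv.
have [eV|/eqP nV] := eqVneq V fullv.
  by left; rewrite -UV0 eV capvf.
case: nk; apply/eqP; rewrite eqEsubv subvf /= -{1}UV subv_add.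
by rewrite !(submodule_cover Ls small).
Qed.

(** Lift [q] to a map from [Q] to [P]. It is onto by superfluity and split because [P] is
    projective; the section is bijective because [Q] is indecomposable. *)
Lemma cover_indec_iso P L (p : rhom P L) Q (q : rhom Q L) : simple_rmod L ->
  surjective_rhom p -> superfluous_ker p -> projective_rmod P ->
  projective_rmod Q -> indecomposable Q -> surjective_rhom q -> rmod_iso P Q.
Proof.
move=> Ls ps small Pp Qp Qi qs.
have [h ph] := Qp _ _ p q ps.
have hs : surjective_rhom h.
  apply: small; first exact/submodule_img/submodule_full.
  apply/vspaceP => x; rewrite memvf; apply/memv_addP.
  have /surjP/(_ (p x))[y E] := qs.
  exists (h y); first by rewrite memv_img ?memvf.
  exists (x - h y); last by rewrite addrC subrK.
  by rewrite memv_ker linearB /= -[p (h y)]rcompE ph E subrr.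
have [s hs1] := Pp _ _ h (rid P) hs.
exists s; apply: (@split_indecomposable _ _ _ _ s h) => //.
  by case: (cover_indecomposable Ls ps small).
by exists id => x; rewrite hs1 ridE.
Qed.

Lemma regular_projective : projective_rmod (regular_rmod A).
Proof.
move=> M N g f /surjP gs; have [m gm] := gs (f (1 : A)).
exists (elem_hom m); apply: rhom_eq => a.
rewrite rcompE elem_homE rfunP gm -rfunP; congr (f _); exact: mul1r.
Qed.

Lemma split_projective P Q (i : rhom P Q) (r : rhom Q P) :
  rcomp r i = rid P -> projective_rmod Q -> projective_rmod P.
Proof.
move=> ri Qp M N g f gs; have [h gh] := Qp _ _ g (rcomp f r) gs.
exists (rcomp h i); apply: rhom_eq => x.
rewrite !rcompE -[g _]rcompE gh rcompE -[r _]rcompE ri ridE //.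
Qed.

(** The [e i] are the components of 1 in the decomposition. *)
Lemma direct_sum_idempotents m (Q : 'I_m -> rmod A) :
  direct_sum_of (regular_rmod A) Q ->
  exists e : 'I_m -> A, exists f : forall i, rhom (Q i) (regular_rmod A),
  [/\ \sum_i e i = 1, forall i, e i * e i = e i,
      forall i j, i != j -> e i * e j = 0, forall i, injective (f i) &
      forall i (a : A), a \in limg (f i) <-> e i * a = a].
Proof.
case=> f [fi fd ff].
have /memv_sumP[e eP e1] : (1 : A) \in (\sum_(i < m) limg (f i))%VS by rewrite ff memvf.
have mem i (a b : A) : a \in limg (f i) -> a * b \in limg (f i).
  exact: (@submodule_img _ _ _ _ (f i) _ (@submodule_full _ _ _) a b).
(* Both families decompose [a] along the direct sum, and decompositions are unique. *)
have comp i (a : A) : a \in limg (f i) -> forall j, e j * a = if j == i then a else 0.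
  move=> ai j; have /directv_sum_unique U := fd.
  have H1 k : predT k -> e k * a \in limg (f k) by move=> _; apply: mem; apply: eP.
  have H2 k : predT k -> (if k == i then a else 0) \in limg (f k).
    by move=> _; case: eqP => [->|_] //; exact: mem0v.
  have := U _ _ H1 H2.
  rewrite -mulr_suml -[\sum_(j < m) e j]e1 mul1r -big_mkcond big_pred1_eq eqxx.
  by move/esym/forall_inP => H; apply/eqP/H.
exists e, f; split=> //.
- by move=> i; rewrite (comp i) ?eqxx // eP.
- by move=> i j ij; rewrite (comp j) ?(negbTE ij) // eP.
- move=> i a; split=> [ai|<-]; first by rewrite (comp i) ?eqxx.
  by apply: mem; apply: eP.
Qed.

Lemma left_mul_hom (M : rmod A) (f : rhom M (regular_rmod A)) (e : A) :
  injective f -> (forall a : A, a \in limg f <-> e * a = a) -> e * e = e ->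
  exists r : rhom (regular_rmod A) M, (forall a : A, f (r a) = e * a) /\ rcomp r f = rid M.
Proof.
move=> fi fP ee.
have [|r fr] := lift_mono (g := f) (f := elem_hom (e : regular_rmod A)) fi.
  apply/subvP => _ /memv_imgP[a _ ->]; rewrite [X in X \in _]elem_homE.
  by apply/fP; rewrite /= mulrA ee.
have frE a : f (r a) = e * a by rewrite -rcompE fr elem_homE.
exists r; split=> //; apply: rhom_eq => x; apply: fi.
by rewrite rcompE ridE frE; apply/fP; rewrite memv_img ?memvf.
Qed.

(** The summands [Q j] given by basicness are matched with the covers [P i]: they are isomorphic as
    soon as [Q j] maps onto [L i]. Since the [Q j], like the [L i], are pairwise nonisomorphic, the
    matching [t] is a bijection. *)
Lemma basic_idempotents n (L P : 'I_n -> rmod A) : basic_algebra A ->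
  representatives (@simple_rmod K A) L ->
  (forall i, projective_cover (P i) (L i)) ->
  exists e : 'I_n -> A, exists f : forall i, rhom (P i) (regular_rmod A),
  [/\ \sum_i e i = 1, forall i, e i * e i = e i,
      forall i j, i != j -> e i * e j = 0, forall i, injective (f i) &
      forall i (a : A), a \in limg (f i) <-> e i * a = a].
Proof.
case=> m [Q [AQ Qi Qinj]] [Ls Linj Lsurj] cov.
have [e [f [e1 ee eo fi fP]]] := direct_sum_idempotents AQ.
have Qp j : projective_rmod (Q j).
  have [r [_ rf]] := left_mul_hom (fi j) (fP j) (ee j).
  exact: split_projective rf regular_projective.
have isoPQ i j (q : rhom (Q j) (L i)) : surjective_rhom q -> rmod_iso (P i) (Q j).
  have [Pp [p [ps small]]] := cov i.
  exact: (cover_indec_iso (Ls i) ps small Pp (Qp j) (Qi j)).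
(* The [e j] sum to 1, so one of them moves a nonzero [x] of [L i] to a nonzero vector, and [Q j]
   maps onto [L i]. *)
have /choice[t tP] i : exists j, rmod_iso (P i) (Q j).
  have [/not_fullv0[x x0] _] := Ls i.
  have [j xj] : exists j, ract x (e j) != 0.
    apply: contrapT => /forallNP h; case/negP: x0.
    rewrite -(ract1 x) -e1 ract_sumr big1 // => j _.
    by apply/eqP/negPn/negP/h.
  exists j; have /memv_imgP[y _ ey] : e j \in limg (f j) by apply/fP.
  apply: (@isoPQ i j (rcomp (elem_hom x) (f j))).
  apply: (@to_simple_surj _ _ _ _ _ y) => //.
  by rewrite rcompE -ey elem_homE.
have tinj : injective t.
  move=> i i' tii; apply: Linj.
  have [_ [p [ps small]]] := cov i; have [_ [p' [ps' small']]] := cov i'.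
  have [h bh] : rmod_iso (P i) (P i').
    by apply: iso_trans (tP i) _; rewrite tii; apply: iso_sym.
  have [/not_fullv0[y y0] _] := Ls i'.
  have /surjP/(_ y)[z pz] := ps'; have /surjP/(_ z)[x hx] := bij_surj bh.
  apply: (@cover_iso _ _ p _ (rcomp p' h) x) => //.
  by rewrite rcompE hx pz.
have tsurj j : exists i, t i = j.
  have [/simple_quotient[S [q [Ss qs]]] _] := Qi j.
  have [i iso] := Lsurj _ Ss; exists i; apply: Qinj.
  apply: iso_trans (iso_sym (tP i)) _.
  have [h bh] := iso; apply: (@isoPQ i j (rcomp h q)).
  apply/surjP => y; have /surjP/(_ y)[z <-] := bij_surj bh.
  by have /surjP/(_ z)[x <-] := qs; exists x; rewrite rcompE.
have [u tu] := choice tsurj.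
have tbij : bijective t by exists u => // i; apply: tinj; rewrite tu.
pose h i := projT1 (cid (tP i)); have hb i : bijective (h i) := projT2 (cid (tP i)).
exists (e \o t), (fun i => rcomp (f (t i)) (h i)); split=> //=.
- by rewrite -e1 (reindex t) //; apply: onW_bij.
- by move=> i j ij; apply: eo; rewrite (inj_eq tinj).
- by move=> i x y; rewrite /= !comp_lfunE => /fi/(bij_inj (hb i)).
move=> i a; rewrite -fP; split=> /memv_imgP[x _ ->].
  by rewrite /= comp_lfunE memv_img ?memvf.
have /surjP/(_ x)[z <-] := bij_surj (hb i).
by apply/memv_imgP; exists z; rewrite ?memvf //= comp_lfunE.
Qed.

End Covers.

(** Schur's lemma: an eigenvalue exists over an algebraically closed field, and its eigenspace is a
    nonzero submodule. *)
Lemma simple_endomorphism (K : closedFieldType) (A : falgType K) (S : rmod A) (f : rhom S S) :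
  simple_rmod S -> exists c, forall x, f x = c *: x.
Proof.
move=> [S0 Ss].
have eb := vbasisP (fullv : {vspace S}).
have [c] : exists c, root (char_poly (passmx.mxof (vbasis fullv) (vbasis fullv) f)) c.
  apply/closed_rootP; rewrite size_char_poly eqSS dimv_eq0; exact/eqP.
rewrite -eigenvalue_root_char /eigenvalue => nz.
have : passmx.leigenspace f c != 0%VS by rewrite (passmx.leigenspaceE eb) passmx.vsof_eq0.
rewrite /passmx.leigenspace => /eqP k0; exists c => x.
have fE y : (rfun f - c *: \1%VF) y = f y - c *: y.
  by rewrite !lfun_simp.
have [|//|k1] := Ss (lker (rfun f - c *: \1%VF)).
  move=> y a; rewrite !memv_ker !fE !subr_eq0 => /eqP e.
  by rewrite rfunP e ractZl.
by apply/eqP; rewrite -subr_eq0 -fE -memv_ker k1 memvf.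
Qed.

Lemma lin_combD (K : fieldType) (V : lmodType K) (c d c' d' : K) (x y : V) :
  (c + c') *: x + (d + d') *: y = (c *: x + d *: y) + (c' *: x + d' *: y).
Proof. by rewrite !scalerDl addrACA. Qed.

Lemma lin_combZ (K : fieldType) (V : lmodType K) (k c d : K) (x y : V) :
  (k * c) *: x + (k * d) *: y = k *: (c *: x + d *: y).
Proof. by rewrite scalerDr !scalerA. Qed.

(** * Recognizing B_n by generators *)

Section Generators.
Variables (K : fieldType) (A : falgType K) (n : nat).
Variables (e : 'I_n -> A) (al : 'I_n -> 'I_n -> A) (z : 'I_n -> A).
Let adj (i j : 'I_n) := (j == i.+1 :> nat) || (i == j.+1 :> nat).
(** [X'] and [Y'] are the intended spanning elements of the corners: trivial paths and arrows, and
    two-cycles. *)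
Let X' (i j : 'I_n) : A := if i == j then e i else if adj i j then al i j else 0.
Let Y' (i j : 'I_n) : A := if i == j then z i else 0.
Hypothesis e_sum : \sum_i e i = 1.
Hypothesis e_idem : forall i, e i * e i = e i.
Hypothesis e_orth : forall i j : 'I_n, i != j -> e i * e j = 0.
Hypothesis al_l : forall i j, adj i j -> e i * al i j = al i j.
Hypothesis al_r : forall i j, adj i j -> al i j * e j = al i j.
Hypothesis al_cycle : forall i j, adj i j -> al i j * al j i = z i.
Hypothesis al_noncycle : forall i j k, adj i j -> adj j k -> i != k -> al i j * al j k = 0.
Hypothesis z_al : forall i j, adj i j -> z i * al i j = 0.
Hypothesis z_last : forall i : 'I_n, i.+1 = n -> z i = 0.
Hypothesis corner_span : forall a i j, exists c d, e i * a * e j = c *: X' i j + d *: Y' i j.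
Hypothesis e_neq0 : forall i, e i != 0.
Hypothesis al_neq0 : forall i j, adj i j -> al i j != 0.
Hypothesis z_neq0 : forall i : 'I_n, (i.+1 < n)%N -> z i != 0.

Local Notation Q := (B_quiver n).
Local Notation kQ := (path_algebra K Q).
Implicit Types (p q : qpath Q) (a : B_arrow n) (s : seq (B_arrow n)).

Let prod_al s : A := \prod_(a <- s) al (val a).1 (val a).2.

Definition path_value p : A := e (psrc p) * prod_al (parrows p).

Lemma prod_al_tgt (v : vertex Q) s : composable v s ->
  e v * prod_al s * e (last v (map (@qtgt Q) s)) = e v * prod_al s.
Proof.
elim: s v => [|a s IH] v /=; first by rewrite /prod_al big_nil mulr1 e_idem.
case/andP => /eqP av cs; rewrite /prod_al big_cons -/(prod_al s).
have aa : adj (val a).1 (val a).2 by exact: (valP a).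
rewrite -{1 2}(al_r aa) -!mulrA; congr (_ * (_ * _)).
by rewrite mulrA; apply: IH.
Qed.

Lemma path_value_tgt p : path_value p * e (ptgt p) = path_value p.
Proof. exact: prod_al_tgt (valP p). Qed.

Lemma path_value_trivial (v : 'I_n) : path_value (ptrivial (v : vertex Q)) = e v.
Proof. by rewrite /path_value /prod_al big_nil mulr1. Qed.

Lemma path_value_cat p q :
  path_value p * path_value q = (if pcat p q is Some r then path_value r else 0).
Proof.
case: (pcatP p q) => [r pq sr tr ar|npq].
  rewrite {2}/path_value mulrA -pq path_value_tgt /path_value sr ar /prod_al big_cat /=.
  by rewrite mulrA.
rewrite -path_value_tgt {2}/path_value mulrA -[_ * _ * e (psrc q)]mulrA e_orth.
  by rewrite mulr0 mul0r.
exact/eqP.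
Qed.

Definition path_eval (f : kQ) : A := \sum_(p <- msupp f) mcoeff p f *: path_value p.

Lemma path_evalEw (D : {fset qpath Q}) f : (msupp f `<=` D)%fset ->
  path_eval f = \sum_(p <- D) mcoeff p f *: path_value p.
Proof.
move=> sD; rewrite /path_eval (big_fset_incl _ sD) //= => p _ /mcoeff_outdom ->.
by rewrite scale0r.
Qed.

Lemma path_evalD f g : path_eval (f + g) = path_eval f + path_eval g.
Proof.
rewrite (path_evalEw (msuppD_le f g)) (path_evalEw (fsubsetUl (msupp f) (msupp g))).
rewrite (path_evalEw (fsubsetUr (msupp f) (msupp g))) -big_split.
by apply: eq_bigr => p _; rewrite mcoeffD scalerDl.
Qed.

Lemma path_evalZ c f : path_eval (c *: f) = c *: path_eval f.
Proof.
rewrite (path_evalEw (msuppZ_le c f)) scaler_sumr.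
by apply: eq_bigr => p _; rewrite mcoeffZ scalerA.
Qed.

Lemma path_eval0 : path_eval 0 = 0.
Proof. by rewrite /path_eval msupp0 big_seq_fset0. Qed.

Lemma path_eval_basis p : path_eval (pbasis K p) = path_value p.
Proof.
by rewrite pbasis.unlock (path_evalEw (msuppU_le)) big_seq_fset1 mcoeffUU scale1r.
Qed.

Lemma path_evalM (f g : kQ) : path_eval (f * g) = path_eval f * path_eval g.
Proof.
elim/pbasis_ind: f => [|f1 f2 IH1 IH2|c f IH|p].
- by rewrite mul0r path_eval0 mul0r.
- by rewrite mulrDl !path_evalD IH1 IH2 mulrDl.
- apply: etrans (congr1 path_eval (esym (path_scalerAl c f g))) _.
  apply: etrans (path_evalZ c (f * g)) _; rewrite IH scalerAl.
  by congr (_ * _); exact: esym (path_evalZ c f).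
elim/pbasis_ind: g => [|f1 f2 IH1 IH2|c f IH|q].
- by rewrite mulr0 path_eval0 mulr0.
- by rewrite mulrDr !path_evalD IH1 IH2 mulrDr.
- apply: etrans (congr1 path_eval (esym (path_scalerAr c _ f))) _.
  apply: etrans (path_evalZ c _) _; rewrite IH scalerAr.
  by congr (_ * _); exact: esym (path_evalZ c f).
rewrite !path_eval_basis path_value_cat -[_ * _]/(pmul _ _) pmul_basis.
by case: (pcat p q) => [r|] /=; rewrite ?path_eval_basis ?path_eval0.
Qed.

Lemma path_length2 p : plength p = 2 -> exists a b : B_arrow n,
  [/\ parrows p = [:: a; b], psrc p = (val a).1, (val b).1 = (val a).2 & ptgt p = (val b).2].
Proof.
case: p => [[v [|a [|b [|]]]] cp] //= _; exists a, b; have /= /and3P[/eqP av /eqP ab _] := cp.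
by split.
Qed.

Lemma path_value2 p : plength p = 2 ->
  path_value p = if psrc p == ptgt p then z (psrc p) else 0.
Proof.
move=> /path_length2[a [b [pE sp ab tp]]].
have aa : adj (val a).1 (val a).2 := valP a.
have ba : adj (val b).1 (val b).2 := valP b.
rewrite /path_value pE /prod_al !big_cons big_nil mulr1 sp tp mulrA al_l // ab.
rewrite ab in ba; have [E|ne] := eqVneq (val a).1 (val b).2; last exact: al_noncycle.
by rewrite -E al_cycle.
Qed.

Lemma path_eval_relation f : B_relation f -> path_eval f = 0.
Proof.
case=> [p p3|p p2 np|v p q p2 sp tp q2 sq tq|v p vn p2 sp tp].
- rewrite path_eval_basis; move: p3; case: p => [[v [|a [|b [|c [|]]]]] cp] //= _.
  have /= /and4P[/eqP av /eqP ab /eqP bc _] := cp.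
  have aa : adj (val a).1 (val a).2 := valP a.
  have ba : adj (val b).1 (val b).2 := valP b.
  have ca : adj (val c).1 (val c).2 := valP c.
  rewrite /path_value /parrows /psrc /= /prod_al !big_cons big_nil mulr1.
  have -> : v = (val a).1 by [].
  rewrite mulrA al_l // mulrA.
  have {}ab : (val b).1 = (val a).2 := ab; have {}bc : (val c).1 = (val b).2 := bc.
  rewrite ab in ba *; rewrite bc in ca *.
  (* The first two arrows multiply to 0 or to [z], and [z] kills the third. *)
  have [E|ne] := eqVneq (val a).1 (val b).2; last by rewrite al_noncycle ?mul0r.
  by rewrite -E al_cycle // z_al // E.
- by rewrite path_eval_basis path_value2 //; case: eqP.
- rewrite -[_ - _]/(_ + - _) -scaleN1r path_evalD path_evalZ !path_eval_basis.
  by rewrite !path_value2 // sp tp sq tq eqxx scaleN1r subrr.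
by rewrite path_eval_basis path_value2 // sp tp eqxx z_last.
Qed.

Local Notation J := (ideal_generated (@B_relation K n)).

Lemma path_eval_ideal f : J f -> path_eval f = 0.
Proof.
move=> /(_ (fun f => path_eval f = 0)); apply; last exact: path_eval_relation.
split=> [|x y x0 y0|a x x0|a x x0]; first exact: path_eval0.
- by rewrite path_evalD x0 y0 addr0.
- by rewrite path_evalM x0 mulr0.
- by rewrite path_evalM x0 mul0r.
Qed.

Local Open Scope quotient_scope.
Local Notation qA := (bound_quiver_algebra (@B_relation K n)).
Let cls (f : kQ) : qA := \pi_qA f.

Lemma clsD f g : cls (f + g) = cls f + cls g.
Proof. exact: (esym (@qaddE K Q (@B_relation K n) f g)). Qed.
Lemma clsM (f g : kQ) : cls (f * g) = cls f * cls g.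
Proof. exact: (esym (@qmulE K Q (@B_relation K n) f g)). Qed.
Lemma clsZ c f : cls (c *: f) = c *: cls f.
Proof. exact: (esym (@qscaleE K Q (@B_relation K n) c f)). Qed.
Lemma cls0 : cls 0 = 0. Proof. by []. Qed.
Lemma cls_ideal f : J f -> cls f = 0.
Proof. by move=> Jf; apply: qpi_eq; rewrite subr0. Qed.

Definition bound_eval (b : qA) : A := path_eval (repr b).

Lemma bound_evalE f : bound_eval (cls f) = path_eval f.
Proof.
apply/eqP; rewrite -subr_eq0 -scaleN1r -path_evalZ -path_evalD scaleN1r.
apply/eqP; apply: path_eval_ideal; exact: (@qreprP K Q (@B_relation K n) f).
Qed.

Lemma clsP (x : qA) : exists f, x = cls f.
Proof. by exists (repr x); rewrite /cls reprK. Qed.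

Lemma bound_evalD x y : bound_eval (x + y) = bound_eval x + bound_eval y.
Proof.
have [f ->] := clsP x; have [g ->] := clsP y.
by rewrite -clsD !bound_evalE path_evalD.
Qed.

Lemma bound_evalM x y : bound_eval (x * y) = bound_eval x * bound_eval y.
Proof.
have [f ->] := clsP x; have [g ->] := clsP y.
by rewrite -clsM !bound_evalE path_evalM.
Qed.

Lemma bound_evalZ c x : bound_eval (c *: x) = c *: bound_eval x.
Proof. by have [f ->] := clsP x; rewrite -clsZ !bound_evalE path_evalZ. Qed.

Lemma bound_eval0 : bound_eval 0 = 0.
Proof. by rewrite -cls0 bound_evalE path_eval0. Qed.

Lemma path_eval1 : path_eval 1 = 1.
Proof.
rewrite -[1 in LHS]/(pone K Q) /pone (big_morph _ path_evalD path_eval0) -e_sum.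
by apply: eq_bigr => v _; rewrite path_eval_basis path_value_trivial.
Qed.

Lemma bound_eval1 : bound_eval 1 = 1.
Proof. by rewrite -[1 in LHS]/(cls 1) bound_evalE path_eval1. Qed.

Let is_cycle (i : 'I_n) p := [/\ plength p = 2, psrc p = i & ptgt p = i].

Lemma composable1 (a : B_arrow n) : @composable Q (val a).1 [:: a].
Proof. by rewrite /= andbT. Qed.

Definition arrow_path a : qpath Q := @QPath Q ((val a).1, [:: a]) (composable1 a).

(** [X] and [Y] are the counterparts in [B_n] of [X'] and [Y']. On the diagonal [Y] is the class of
    a chosen two-cycle, or 0 when there is none. *)
Let X (i j : 'I_n) : qA := if i == j then cls (pbasis K (ptrivial (i : vertex Q)))
  else if insub (i, j) is Some a then cls (pbasis K (arrow_path a)) else 0.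
Let Y (i j : 'I_n) : qA := if i == j then
  (if pselect (exists p, is_cycle i p) is left ex then cls (pbasis K (projT1 (cid ex))) else 0)
  else 0.

Lemma exists_cycle (i : 'I_n) : (i.+1 < n)%N -> exists p, is_cycle i p.
Proof.
move=> ltin; pose j := Ordinal ltin.
have ij : adj i j by rewrite /adj /= eqxx.
have ji : adj j i by rewrite /adj /= eqxx orbT.
pose a : B_arrow n := exist _ (i, j) ij; pose b : B_arrow n := exist _ (j, i) ji.
have cp : @composable Q i [:: a; b] by rewrite /= !eqxx.
by exists (@QPath Q (i, [:: a; b]) cp); split.
Qed.

Lemma bound_evalX i j : bound_eval (X i j) = X' i j.
Proof.
rewrite /X /X'; have [_|_] := eqVneq i j.
  by rewrite bound_evalE path_eval_basis path_value_trivial.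
case: insubP => [a aP aE|/negbTE nadj] /=; last by rewrite bound_eval0 /adj nadj.
rewrite bound_evalE path_eval_basis /path_value /prod_al big_seq1 /psrc /= aE /=.
by rewrite /adj aP al_l.
Qed.

Lemma bound_evalY i j : bound_eval (Y i j) = Y' i j.
Proof.
rewrite /Y /Y'; have [_|_] := eqVneq i j; last exact: bound_eval0.
case: pselect => [ex|nex].
  case: (cid ex) => p [p2 sp tp] /=.
  by rewrite bound_evalE path_eval_basis path_value2 // sp tp eqxx.
rewrite bound_eval0 z_last //; apply/eqP; rewrite eqn_leq ltn_ord /= leqNgt.
by apply/negP => /exists_cycle.
Qed.

Lemma cls_long_path p : (2 < plength p)%N -> cls (pbasis K p) = 0.
Proof.
case: p => [[v [|a [|b [|c s]]]] cp] // _.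
have /= /and4P[av ab bc cs] := cp.
have c1 : @composable Q v [:: a; b; c] by rewrite /= av ab bc.
pose p1 := @QPath Q (v, [:: a; b; c]) c1; pose p2 := @QPath Q (qtgt c, s) cs.
apply: cls_ideal; have -> : pbasis K (@QPath Q (v, [:: a, b, c & s]) cp) =
    (pbasis K p1 : kQ) * pbasis K p2.
  rewrite -[RHS]/(pmul _ _) pmul_basis; case: (pcatP p1 p2) => [r _ sr _ ar|] //=.
  by congr (pbasis K _); apply: qpath_inj; rewrite ?sr ?ar.
by apply: JMr; move=> I idI; apply; apply: B_length3.
Qed.

(** Modulo the relations a path vanishes or is a trivial path, an arrow or the chosen two-cycle, so
    [X] and [Y] span the corners of [B_n]. *)
Lemma cls_path p :
  exists c d, cls (pbasis K p) = c *: X (psrc p) (ptgt p) + d *: Y (psrc p) (ptgt p).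
Proof.
have [l2|] := ltnP 2 (plength p).
  by exists 0, 0; rewrite !scale0r addr0 cls_long_path.
rewrite leq_eqVlt => /orP[/eqP p2|].
  have [E|ne] := eqVneq (psrc p) (ptgt p); last first.
    exists 0, 0; rewrite !scale0r addr0; apply: cls_ideal => I idI; apply.
    by apply: B_noncycle => //; apply/eqP.
  exists 0, 1; rewrite scale0r add0r scale1r /Y E eqxx.
  case: pselect => [ex|[]]; last by exists p; split.
  case: (cid ex) => q [q2 sq tq] /=; apply: qpi_eq => I idI; apply.
  exact: (@B_cycles K n (ptgt p)).
case: p => [[v [|a [|]]] cp] //= _.
  exists 1, 0; rewrite scale1r scale0r addr0 /X eqxx.
  by congr (cls (pbasis K _)); apply: qpath_inj.
have av : (val a).1 = v by have /= /andP[/eqP] := cp.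
subst v.
have aa : adj (val a).1 (val a).2 := valP a.
exists 1, 0; rewrite scale1r scale0r addr0 /X /psrc /ptgt /=.
have -> : ((val a).1 == (val a).2) = false.
  apply/eqP => E; move: aa; rewrite /adj -E => /orP[]; rewrite (ltn_eqF (ltnSn _)) //.
case: insubP => [a' _ a'E|]; last by rewrite -[_ || _]/(adj (val a).1 (val a).2) aa.
have E : a' = a by apply: val_inj; rewrite a'E; exact: esym (surjective_pairing _).
subst a'.
by congr (cls (pbasis K _)); apply: qpath_inj.
Qed.

Let tr (i : 'I_n) : kQ := pbasis K (ptrivial (i : vertex Q)).

Lemma cls_corner f i j : exists c d, cls (tr i * f * tr j) = c *: X i j + d *: Y i j.
Proof.
elim/pbasis_ind: f => [|f1 f2 [c1 [d1 IH1]] [c2 [d2 IH2]]|k f [c [d IH]]|p].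
- by exists 0, 0; rewrite mulr0 mul0r cls0 !scale0r addr0.
- exists (c1 + c2), (d1 + d2); rewrite mulrDr mulrDl clsD IH1 IH2.
  exact: esym (lin_combD _ _ _ _ _ _).
- exists (k * c), (k * d); rewrite lin_combZ -IH -clsZ; congr (cls _).
  apply: etrans (esym (path_scalerAl k _ (tr j))); congr (_ * _).
  exact: esym (path_scalerAr k (tr i) f).
rewrite -[tr i * _]/(pmul _ _) pmul_basis pcat1l.
have [->|_] := eqVneq (i : vertex Q) (psrc p); last first.
  by exists 0, 0; rewrite /= mul0r cls0 !scale0r addr0.
rewrite /= -[_ * tr j]/(pmul _ _) pmul_basis pcat1r.
have [<-|_] := eqVneq (ptgt p) (j : vertex Q); last first.
  by exists 0, 0; rewrite /= cls0 !scale0r addr0.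
exact: cls_path.
Qed.

(** Every linear relation between the values in [A] already holds in [B_n]. On the diagonal,
    multiplying by [z i], whose square is 0, isolates the coefficient of [e i]. *)
Lemma corner_independent i j c d :
  c *: X' i j + d *: Y' i j = 0 -> c *: X i j + d *: Y i j = 0.
Proof.
rewrite /X' /Y' /X /Y; have [_|ne] := eqVneq i j.
  have zz k : z k * z k = 0.
    have [kn|kn] := boolP (k.+1 < n)%N; last first.
      by rewrite z_last ?mul0r //; apply/eqP; rewrite eqn_leq ltn_ord leqNgt.
    have a1 : adj k (Ordinal kn) by rewrite /adj eqxx.
    by rewrite -{2}(al_cycle a1) mulrA z_al // mul0r.
  have ze : z i * e i = z i.
    have [kn|kn] := boolP (i.+1 < n)%N; last first.
      by rewrite z_last ?mul0r //; apply/eqP; rewrite eqn_leq ltn_ord leqNgt.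
    have a1 : adj i (Ordinal kn) by rewrite /adj eqxx.
    have a2 : adj (Ordinal kn) i by rewrite /adj eqxx orbT.
    by rewrite -(al_cycle a1) -mulrA al_r.
  move=> E; have cz : c *: z i = 0.
    have := congr1 (fun x => z i * x) E.
    by rewrite mulrDr -!scalerAr ze zz scaler0 addr0 mulr0.
  have [kn|kn] := boolP (i.+1 < n)%N.
    have c0 : c = 0.
      by move/eqP: cz; rewrite scaler_eq0 (negbTE (z_neq0 kn)) orbF => /eqP.
    move: E; rewrite c0 !scale0r !add0r => /eqP.
    by rewrite scaler_eq0 (negbTE (z_neq0 kn)) orbF => /eqP->; rewrite scale0r.
  have il : i.+1 = n by apply/eqP; rewrite eqn_leq ltn_ord leqNgt.
  move/eqP: E; rewrite z_last // scaler0 addr0 scaler_eq0 (negbTE (e_neq0 i)) orbF.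
  move=> /eqP->; rewrite scale0r add0r; case: pselect => [ex|_]; last by rewrite scaler0.
  case: (cid ex) => q [q2 sq tq] /=; rewrite cls_ideal ?scaler0 // => I idI; apply.
  exact: (@B_last K n i).
rewrite !scaler0 !addr0; case: insubP => [a aP aE|]; last by rewrite scaler0.
rewrite {1}/adj aP => /eqP; rewrite scaler_eq0 (negbTE (al_neq0 aP)) orbF => /eqP->.
by rewrite scale0r.
Qed.

Lemma sum_corners f : f = \sum_i \sum_j tr i * f * tr j.
Proof.
have t1 : \sum_i tr i = 1 by [].
under eq_bigr do rewrite -mulr_sumr t1 mulr1.
by rewrite -mulr_suml t1 mul1r.
Qed.

Lemma bound_eval_inj x y : bound_eval x = bound_eval y -> x = y.
Proof.
move=> E; apply/eqP; rewrite -subr_eq0; apply/eqP.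
have : bound_eval (x - y) = 0.
  by rewrite bound_evalD -scaleN1r bound_evalZ E scaleN1r subrr.
have [f ->] := clsP (x - y); rewrite bound_evalE => f0.
rewrite [f]sum_corners (big_morph cls clsD cls0) big1 // => i _.
rewrite (big_morph cls clsD cls0) big1 // => j _.
have [c [d cd]] := cls_corner f i j; rewrite cd; apply: corner_independent.
rewrite -bound_evalX -bound_evalY -!bound_evalZ -bound_evalD -cd bound_evalE.
by rewrite !path_evalM f0 mulr0 mul0r.
Qed.

Lemma bound_eval_surj (a : A) : exists x, bound_eval x = a.
Proof.
have aE : a = \sum_i \sum_j e i * a * e j.
  under eq_bigr do rewrite -mulr_sumr e_sum mulr1.
  by rewrite -mulr_suml e_sum mul1r.
have /choice[c cP] (ij : 'I_n * 'I_n) : exists c : K * K,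
    e ij.1 * a * e ij.2 = c.1 *: X' ij.1 ij.2 + c.2 *: Y' ij.1 ij.2.
  by have [c [d cd]] := corner_span a ij.1 ij.2; exists (c, d).
exists (\sum_i \sum_j ((c (i, j)).1 *: X i j + (c (i, j)).2 *: Y i j)).
rewrite [RHS]aE (big_morph _ bound_evalD bound_eval0); apply: eq_bigr => i _.
rewrite (big_morph _ bound_evalD bound_eval0); apply: eq_bigr => j _.
have /= -> := cP (i, j).
apply: etrans (bound_evalD _ _) _; congr (_ + _).
  by apply: etrans (bound_evalZ _ _) _; congr (_ *: _); exact: bound_evalX.
by apply: etrans (bound_evalZ _ _) _; congr (_ *: _); exact: bound_evalY.
Qed.

Lemma iso_to_B_of_generators : iso_to_B A n.
Proof.
(* Evaluation runs from [B_n] to [A]; the isomorphism asked for is its inverse. *)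
have [f fK] := choice bound_eval_surj.
have Kf : cancel bound_eval f by move=> x; apply: bound_eval_inj; rewrite fK.
exists f; split.
- move=> c a b; apply: bound_eval_inj.
  by rewrite bound_evalD bound_evalZ !fK.
- split=> [|a b]; apply: bound_eval_inj; first by rewrite fK bound_eval1.
  by rewrite bound_evalM !fK.
by exists bound_eval.
Qed.

End Generators.

(** * The structure of A *)

(** A pairing without left kernel embeds [U1] into the dual of [U2], realized as row vectors of
    values on a basis. *)
Lemma dim_pairing (K : fieldType) (V W : vectType K) (U1 : {vspace V}) (U2 : {vspace W})
    (b : V -> W -> K) :
  (forall w, scalar (b^~ w)) -> (forall v, scalar (b v)) ->
  (forall v, v \in U1 -> v != 0 -> exists2 w, w \in U2 & b v w != 0) ->
  (\dim U1 <= \dim U2)%N.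
Proof.
move=> bl br nondeg.
pose f0 v : 'rV[K]_(\dim U2) := \row_k b v (vbasis U2)`_k.
have f0_lin : linear f0.
  by move=> c x y; apply/rowP => k; rewrite !mxE bl.
pose h := GRing.isLinear.Build K V 'rV[K]_(\dim U2) *:%R f0 f0_lin.
pose F : {linear V -> 'rV[K]_(\dim U2)} := HB.pack f0 h.
pose f := linfun F.
have fE v : f v = f0 v by rewrite lfunE.
have k0 : (U1 :&: lker f = 0)%VS.
  apply/eqP; rewrite -subv0; apply/subvP => v /memv_capP[vU]; rewrite memv_ker fE memv0.
  move=> /eqP f0v; apply: contraT => v0; have [w wU bw] := nondeg v vU v0.
  case/negP: bw; pose hb := GRing.isLinear.Build K W K *%R (b v) (br v).
  pose B : {scalar W} := HB.pack (b v) hb.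
  rewrite -[b v]/(B : W -> K) (coord_vbasis wU) linear_sum big1 // => k _.
  rewrite linearZ /=; have /rowP/(_ k) := f0v.
  by rewrite !mxE => ->; rewrite mulr0.
rewrite -(limg_dim_eq k0); apply: leq_trans (dimvS (subvf _)) _.
by rewrite dimvf dim_matrix mul1r.
Qed.

Lemma dim1_line (K : fieldType) (V : vectType K) (U : {vspace V}) v w :
  \dim U = 1%N -> v \in U -> v != 0 -> w \in U -> exists c, w = c *: v.
Proof.
move=> d1 vU v0 wU; apply/vlineP; suff -> : <[v]>%VS = U by [].
by apply/eqP; rewrite eqEdim d1 dim_vline v0 andbT -memvE.
Qed.

Section BasicStructure.
Variables (K : closedFieldType) (A : falgType K) (n : nat).
Variables (L P : 'I_n -> rmod A) (e : 'I_n -> A).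
Variable iota : forall i, rhom (P i) (regular_rmod A).
Hypothesis L_simples : representatives (@simple_rmod K A) L.
Hypothesis P_cover : forall i, projective_cover (P i) (L i).
Hypothesis e_sum : \sum_i e i = 1.
Hypothesis e_idem : forall i, e i * e i = e i.
Hypothesis e_orth : forall i j, i != j -> e i * e j = 0.
Hypothesis iota_inj : forall i, injective (iota i).
Hypothesis iotaP : forall i (a : A), a \in limg (iota i) <-> e i * a = a.
Implicit Types (M N S X : rmod A) (i j k : 'I_n).

Let L_simple i : simple_rmod (L i). Proof. by case: L_simples => + _ _; apply. Qed.

(** * One-dimensional simple modules and the radical *)

Lemma mulr_sum_idem (a : A) : a = \sum_i a * e i.
Proof. by rewrite -mulr_sumr e_sum mulr1. Qed.

Lemma mull_sum_idem (a : A) : a = \sum_i e i * a.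
Proof. by rewrite -mulr_suml e_sum mul1r. Qed.

Lemma ract_sum_idem M (x : M) : x = \sum_i ract x (e i).
Proof. by rewrite -ract_sumr e_sum ract1. Qed.

Lemma iotaE i (x : P i) : e i * (iota i x : A) = iota i x.
Proof. by apply/iotaP; rewrite memv_img ?memvf. Qed.

Lemma iota_ract i (x : P i) (a : A) : iota i (ract x a) = (iota i x : A) * a.
Proof. by rewrite rfunP. Qed.

Lemma iota_onto i (a : A) : e i * a = a -> exists x : P i, iota i x = a.
Proof. by move/iotaP/memv_imgP => [x _ ->]; exists x. Qed.

Lemma exists_hom M (m : M) i :
  exists h : rhom (P i) M, forall x, h x = ract m (iota i x).
Proof. by exists (rcomp (elem_hom m) (iota i)) => x; rewrite rcompE elem_homE. Qed.

Lemma exists_generator i : exists g : P i,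
  [/\ iota i g = e i, ract g (e i) = g & forall x, x = ract g (iota i x)].
Proof.
have [g ge] := iota_onto (e_idem i); exists g; split=> // [|x].
  by apply: (@iota_inj i); rewrite iota_ract ge e_idem.
by apply: (@iota_inj i); rewrite iota_ract ge iotaE.
Qed.

(** A nonzero [x * e j] would give a nonzero map from [P j] to [L i], hence an isomorphism of [L j]
    with [L i]. *)
Lemma simple_ract i j (x : L i) : i != j -> ract x (e j) = 0.
Proof.
move=> ij; apply/eqP; apply: contraT => nz.
have [h hE] := exists_hom x j; have [g [ge _ _]] := exists_generator j.
have [_ [p [ps small]]] := P_cover j; have [_ Linj _] := L_simples.
case/eqP: ij; apply/esym/Linj.
by apply: (@cover_iso _ _ _ _ p _ h g) => //; rewrite hE ge.
Qed.

Lemma simple_ract_id i (x : L i) : ract x (e i) = x.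
Proof.
rewrite [RHS]ract_sum_idem (bigD1 i) //= big1 ?addr0 // => j ij.
by rewrite simple_ract // eq_sym.
Qed.

(* Two maps from P_i onto L_i have the same kernel, hence differ by an        *)
(* endomorphism of L_i, which is a scalar.                                    *)
Lemma simple_line i (v w : L i) : v != 0 -> exists c, w = c *: v.
Proof.
move=> v0; have [->|w0] := eqVneq w 0; first by exists 0; rewrite scale0r.
have [_ [p [ps small]]] := P_cover i.
have [g [ge _ _]] := exists_generator i.
have [h hE] := exists_hom v i; have [h' h'E] := exists_hom w i.
have hg : h g = v by rewrite hE ge simple_ract_id.
have h'g : h' g = w by rewrite h'E ge simple_ract_id.
have [||t tE] := factor_surj (g := h) (f := h').
- by apply: (to_simple_surj (m := g)); rewrite ?hg.
- rewrite (cover_ker (p := p) (f := h) (x := g)) ?hg //.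
  by rewrite (cover_ker (p := p) (f := h') (x := g)) ?h'g.
have [c cE] := simple_endomorphism t (L_simple i); exists c.
by rewrite -hg -cE -h'g -tE rcompE.
Qed.

Lemma simple_scalar i (a : A) : exists c, forall x : L i, ract x a = c *: x.
Proof.
have [/not_fullv0[v v0] _] := L_simple i.
have [c ca] := simple_line (ract v a) v0; exists c => x.
by have [d ->] := simple_line x v0; rewrite ractZl ca !scalerA mulrC.
Qed.

(** The Jacobson radical, as the common annihilator of the simple modules. *)
Definition in_radical (a : A) := forall i (x : L i), ract x a = 0.

Lemma radicalMr a b : in_radical a -> in_radical (a * b).
Proof. by move=> ha i x; rewrite ractM ha ract0l. Qed.

(** [a] acts on each [L i] by a scalar [c i], as does the sum of the [c i *: e i]. *)
Lemma radical_decomposition a :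
  exists c : 'I_n -> K, in_radical (a - \sum_i c i *: e i).
Proof.
have /choice[c cE] i : exists c, forall x : L i, ract x a = c *: x.
  exact: simple_scalar.
exists c => i x; rewrite ractBr cE ract_sumr (bigD1 i) //= ractZr simple_ract_id.
rewrite big1 ?addr0 ?subrr // => j ij.
by rewrite ractZr simple_ract ?scaler0 // eq_sym.
Qed.

Lemma radical_offdiag i j a : i != j -> e i * a = a -> a * e j = a -> in_radical a.
Proof.
move=> ij ia aj k x; have [ik|ik] := eqVneq k i.
  subst k; have [c cE] := simple_scalar i a.
  by rewrite -aj ractM cE ractZl simple_ract ?scaler0.
by rewrite -ia ractM simple_ract ?ract0l.
Qed.

(** Otherwise [v * A] has a simple quotient, generated by the image of [v]; but this image equals
    its product with [r], which is 0. *)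
Lemma nakayama (v r : A) : in_radical r -> v * r = v -> v = 0.
Proof.
move=> hr vr; apply/eqP; apply: contraT => v0.
have hN := @submodule_elem _ _ (regular_rmod A) v.
have vN := @mem_elem _ _ (regular_rmod A) v.
have [|S [q [Ss qs]]] := simple_quotient (M := sub_rmod hN).
  move/fullv0P => h; case/negP: v0; have := h (Subvs vN).
  by move/(congr1 vsval)/eqP.
have [_ _ /(_ S Ss)[i [t bt]]] := L_simples.
have qy : q (Subvs vN) = 0.
  apply: (bij_inj bt); rewrite linear0 -(hr i (t (q (Subvs vN)))) -!rfunP.
  congr (t (q _)); apply: subvs_inj; apply: esym.
  by apply: etrans; [exact: (sub_actE hN (Subvs vN) r)|exact: vr].
suff: False by [].
case: Ss => + _; apply; rewrite -qs; apply/eqP; rewrite -lkerE; apply/subvP => x _.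
rewrite memv_ker; have /memv_imgP[a _ xa] := subvsP x.
have -> : x = ract (Subvs vN : sub_rmod hN) a.
  by apply: subvs_inj; rewrite xa elem_homE; apply/esym/(sub_actE hN).
by rewrite rfunP qy ract0l.
Qed.

Lemma idem_neq0 i : e i != 0.
Proof.
have [/not_fullv0[v v0] _] := L_simple i.
by apply: contraNneq v0 => e0; rewrite -(simple_ract_id v) e0 ract0r.
Qed.

Lemma dimE_simple i j : dimE (L i) (e j) = (i == j).
Proof.
have [<-|ij] := eqVneq i j; last by apply/eqP/dimE_eq0 => x; rewrite simple_ract.
have [/not_fullv0[v v0] _] := L_simple i.
apply: etrans (_ : \dim <[v]> = 1%N); last by rewrite dim_vline v0.
congr (\dim _); apply/vspaceP => x; apply/memv_imgP/vlineP => [_|_].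
  exact: simple_line.
by exists x; rewrite ?memvf // actfE simple_ract_id.
Qed.

(** * Corners of A and socles of injective projectives *)

Definition corner i j : {vspace A} := limg (amull (e i) \o amulr (e j))%VF.

Lemma cornerP i j (a : A) : a \in corner i j <-> e i * a = a /\ a * e j = a.
Proof.
split=> [/memv_imgP[b _ ->]|[ia aj]]; last first.
  by apply/memv_imgP; exists a; rewrite ?memvf // comp_lfunE !lfunE /= aj ia.
by rewrite comp_lfunE !lfunE /=; split; [rewrite mulrA e_idem|rewrite -!mulrA e_idem].
Qed.

Lemma corner_mem i j (a : A) : e i * a * e j \in corner i j.
Proof. by apply/cornerP; split; [rewrite !mulrA e_idem|rewrite -!mulrA e_idem]. Qed.

Lemma dimE_proj i j : dimE (P i) (e j) = \dim (corner i j).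
Proof.
rewrite /dimE -(limg_dim_eq (f := iota i)); last first.
  by have /lker0P/eqP-> := @iota_inj i; rewrite capv0.
congr (\dim _); apply/vspaceP => a; apply/idP/idP.
  case/memv_imgP => _ /memv_imgP[x _ ->] ->; apply/cornerP.
  by rewrite actfE iota_ract -mulrA e_idem mulrA iotaE.
case/cornerP => /iota_onto[x xa] aj; apply/memv_imgP; exists x; rewrite ?xa //.
apply/memv_imgP; exists x; rewrite ?memvf // actfE.
by apply: (@iota_inj i); rewrite iota_ract xa aj.
Qed.

Lemma ract_line M (x : M) i (a : A) : ract x (e i) = x ->
  (forall r, in_radical r -> ract x r = 0) -> exists c, ract x a = c *: x.
Proof.
move=> xi xr; have [c hr] := radical_decomposition a; exists (c i).
rewrite -[a](subrK (\sum_i c i *: e i)) ractDr xr // add0r.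
rewrite ract_sumr (bigD1 i) //= ractZr xi big1 ?addr0 // => j ij.
by rewrite -xi -ractM -scalerAr e_orth ?scaler0 ?ract0r // eq_sym.
Qed.

(** [x] spans a copy of [L i] lying in every nonzero submodule of [e i * A]: the socle of [P i] is
    simple and essential, with the same label as its top. *)
Definition socle_generator i (x : A) : Prop :=
  [/\ x != 0, e i * x = x, x * e i = x, forall r, in_radical r -> x * r = 0 &
      forall u, u != 0 -> e i * u = u -> exists a, u * a = x].

(* So v a |-> x a is a well-defined map from v A, whose top is L_i, to x A.   *)
Lemma annihilator_socle i x (v a : A) : socle_generator i x -> v != 0 ->
  v * e i = v -> v * a = 0 -> x * a = 0.
Proof.
move=> [x0 ix xi xr _] v0 vi va.
have [c hr] := radical_decomposition a; set r := _ - _ in hr.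
have aE : a = \sum_j c j *: e j + r by rewrite addrC subrK.
have main y : y * e i = y -> y * a = c i *: y + y * r.
  move=> yi; rewrite aE mulrDr; congr (_ + _).
  rewrite mulr_sumr (bigD1 i) //= -scalerAr yi big1 ?addr0 // => j ij.
  by rewrite -scalerAr -yi -mulrA e_orth ?mulr0 ?scaler0 // eq_sym.
rewrite main // xr // addr0; have [->|c0] := eqVneq (c i) 0; first by rewrite scale0r.
case/negP: v0; apply/eqP/(@nakayama _ (- (c i)^-1 *: r)).
  by move=> j y; rewrite ractZr hr scaler0.
move/eqP: va; rewrite main // addrC addr_eq0 => /eqP vr.
by rewrite -scalerAr vr -scaleNr scalerA mulrNN mulVf // scale1r.
Qed.

(** Sending [v * a] to [x * a] is well defined by [annihilator_socle]; by injectivity this map from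
    [v * A] to [P i] extends to [A], and [u] is the image of 1. *)
Lemma injective_extension i x (v : A) : injective_rmod (P i) ->
  socle_generator i x -> v != 0 -> v * e i = v -> exists2 u, e i * u = u & u * v = x.
Proof.
move=> Pi sx v0 vi; have [_ ix xi xr _] := sx.
have [y yx] := iota_onto ix.
pose hN := @submodule_elem _ _ (regular_rmod A) v.
have [|l lE] := @lift_mono _ _ _ _ _ (sub_inj hN) (elem_hom (v : regular_rmod A))
  (@sub_inj_inj _ _ _ _ hN).
  by rewrite limg_sub_inj.
have lvE a : vsval (l a) = v * a by rewrite -sub_injE -rcompE lE elem_homE.
have [||t tE] := @factor_surj _ _ _ _ _ l (elem_hom y).
- apply/surjP => z; have /memv_imgP[a _ za] := subvsP z.
  by exists a; apply: subvs_inj; rewrite lvE za elem_homE.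
- apply/subvP => a; rewrite !memv_ker => /eqP la; rewrite [X in X == 0]elem_homE.
  apply/eqP/(@iota_inj i); rewrite iota_ract yx linear0.
  by apply: (annihilator_socle sx v0 vi); rewrite -lvE la.
have [h hE] := Pi _ _ (sub_inj hN) t (@sub_inj_inj _ _ _ _ hN).
exists (iota i (h (1 : A))); first exact: iotaE.
rewrite -iota_ract -rfunP -yx; congr (iota i _).
have -> : ract (1 : regular_rmod A) v = sub_inj hN (l (1 : A)).
  by rewrite sub_injE lvE mulr1; exact: mul1r.
by rewrite -rcompE hE -rcompE tE elem_homE ract1.
Qed.

(** As the corner is a line, [x] is a multiple of [e i], so [e i] kills the radical and
    [e i * A * e j = 0] for [j != i]. A nonzero [v] in [e j * A * e i] would give [u * v = x] with
    [u * e j = 0], so that corner vanishes too. Hence [e i] is central, and equal to 1. *)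
Lemma simple_injective_central i x : injective_rmod (P i) ->
  socle_generator i x -> \dim (corner i i) = 1%N -> connected_algebra A ->
  forall j, j = i.
Proof.
move=> Pi sx d1 conn.
have [x0 ix xi xr _] := sx.
have xe : exists2 c, c != 0 & x = c *: e i.
  have iin : e i \in corner i i by apply/cornerP; rewrite e_idem.
  have E : corner i i = <[e i]>%VS.
    apply/esym/eqP; rewrite eqEdim d1 dim_vline idem_neq0 andbT.
    by rewrite -memvE.
  have /vlineP[c xc] : x \in <[e i]>%VS by rewrite -E; apply/cornerP.
  by exists c => //; apply: contraNneq x0 => c0; rewrite xc c0 scale0r.
have [c c0 xc] := xe.
have right j (u : A) : j != i -> e i * u = u -> u * e j = u -> u = 0.
  move=> ji iu uj; have := xr u (radical_offdiag _ iu uj).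
  by rewrite eq_sym xc -scalerAl iu => /(_ ji)/eqP; rewrite scaler_eq0 (negbTE c0) => /eqP.
have left j (v : A) : j != i -> e j * v = v -> v * e i = v -> v = 0.
  move=> ji jv vi; apply/eqP; apply: contraT => v0.
  have [u iu uv] := injective_extension Pi sx v0 vi.
  case/negP: x0; rewrite -uv -jv mulrA (right j (u * e j)) ?mul0r //.
    by rewrite mulrA iu.
  by rewrite -mulrA e_idem.
have central a : e i * a = a * e i.
  rewrite [LHS]mulr_sum_idem [RHS]mull_sum_idem (bigD1 i) //= [RHS](bigD1 i) //= mulrA.
  rewrite !big1 // => j ji.
    apply: (left j) => //; first by rewrite mulrA e_idem.
    by rewrite -!mulrA e_idem.
  apply: (right j) => //; first by rewrite 2!mulrA e_idem.
  by rewrite -!mulrA e_idem.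
have [/eqP|e1] := conn _ (e_idem i) central; first by rewrite (negbTE (idem_neq0 i)).
move=> j; apply/eqP; apply: contraT => ji.
by have := idem_neq0 j; rewrite -[e j]mul1r -e1 e_orth ?eqxx // eq_sym.
Qed.

(** * Injective projectives as duals of projectives *)

Variable D : contrafunctor A.
Variable eta : forall M : rmod A, rhom M (D (D M)).
Hypothesis eta_bij : forall M, bijective (eta M).
Hypothesis eta_nat : forall M N (f : rhom M N),
  rcomp (eta N) f = rcomp (cmap D (cmap D f)) (eta M).
Hypothesis D_simple : forall S, simple_rmod S -> rmod_iso (D S) S.

(** A simple submodule of [P i] is a copy of some [D (L j)]. Its inclusion extends to [D (P j)],
    injectively by [dual_essential], and the extension splits. *)
Lemma injective_proj_dual i : injective_rmod (P i) -> exists j, rmod_iso (D (P j)) (P i).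
Proof.
move=> Pi; have [_ [pi [pis smalli]]] := P_cover i.
have Pind := cover_indecomposable (L_simple i) pis smalli.
have [S [s [Ss si _]]] := simple_submodule (@submodule_full _ _ (P i)) Pind.1.
have [_ _ /(_ S Ss)[j SL]] := L_simples; exists j.
have [t bt] : rmod_iso (D (L j)) S.
  exact: iso_trans (D_simple (L_simple j)) (iso_sym SL).
have [Pp [p [ps small]]] := P_cover j.
have [h hE] := Pi _ _ (cmap D p) (rcomp s t) (dual_surj eta_bij eta_nat ps).
have hi : injective h.
  apply: (dual_essential eta_bij eta_nat ps small) => y z; rewrite hE !rcompE.
  by move/si/(bij_inj bt).
(* Lifting [eta] through the surjective [D h] yields a retraction of [h] up to a bijection, without
   needing [D (P j)] to be injective. *)
have [r rE] := Pp _ _ (cmap D h) (eta (P j)) (dual_inj eta_bij eta_nat hi).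
exists h; apply: (@split_indecomposable _ _ _ _ h (rcomp (cmap D r) (eta (P i)))) => //.
  apply: (dual_nonzero eta_bij eta_nat).
  by case: (cover_indecomposable (L_simple j) ps small).
have -> : rcomp (rcomp (cmap D r) (eta (P i))) h = rcomp (cmap D (eta (P j))) (eta (D (P j))).
  apply: rhom_eq => y; rewrite !rcompE (eta_natE eta_nat) -rE cmap_comp rcompE //.
by apply: rcomp_bij => //; apply: (dual_bij eta_bij eta_nat).
Qed.

(** [P j] has a largest proper submodule with quotient [L j]; dually [D (P j)] has a smallest
    nonzero submodule, a copy of [L j]. *)
Lemma dual_proj_socle j : exists g : rhom (L j) (D (P j)), injective g /\
  forall U : {vspace D (P j)}, submodule U -> U <> 0%VS -> (limg g <= U)%VS.
Proof.
have [_ [p [ps small]]] := P_cover j.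
have [t bt] := iso_sym (D_simple (L_simple j)).
have pi := dual_surj eta_bij eta_nat ps.
exists (rcomp (cmap D p) t); split=> [y z|U hU nU].
  by rewrite !rcompE => /pi/(bij_inj bt).
have [X [q [qs qk]]] := quotient_exists hU.
apply/subvP => _ /memv_imgP[y _ ->]; rewrite -qk memv_ker; apply: contraT => qy.
have qi : injective (rcomp q (rcomp (cmap D p) t)).
  by apply: (from_simple_inj (L_simple j) (m := y)); rewrite rcompE.
case: nU; rewrite -qk; apply/eqP/lker0P.
apply: (dual_essential eta_bij eta_nat ps small) => z z'; rewrite !rcompE => E.
have /surjP bs := bij_surj bt; have [w ew] := bs z; have [w' ew'] := bs z'.
by rewrite -ew -ew'; congr (t _); apply: qi; rewrite !rcompE ew ew'.
Qed.

Lemma dual_proj_iso_socle i : rmod_iso (D (P i)) (P i) -> exists x, socle_generator i x.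
Proof.
case=> h bh; have [g [gi gess]] := dual_proj_socle i.
have [/not_fullv0[m m0] _] := L_simple i.
pose y := h (g m); have yE a : (iota i y : A) * a = iota i (h (g (ract m a))).
  by rewrite !rfunP.
exists (iota i y); split.
- by rewrite -(linear0 (iota i)) (inj_eq (@iota_inj i)) -(linear0 h)
    (inj_eq (bij_inj bh)) -(linear0 g) (inj_eq gi).
- exact: iotaE.
- by rewrite yE simple_ract_id.
- by move=> r hr; rewrite yE hr !linear0.
move=> u u0 iu; have [w wu] := iota_onto iu.
have /surjP/(_ w)[z zw] := bij_surj bh.
have s := gess _ (@submodule_elem _ _ _ z).
have /memv_imgP[a _ ga] : g m \in limg (elem_hom z).
  apply: (subvP (s _)); last by rewrite memv_img ?memvf.
  move=> z0; case/negP: u0; rewrite -wu -zw.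
  by have := mem_elem z; rewrite z0 memv0 => /eqP->; rewrite !linear0.
by exists a; rewrite -wu -zw /y [X in _ = iota i (h X)]ga elem_homE !rfunP.
Qed.

(** Pair [v] and [u] through the coefficient of [x] in [u * v], a linear form on all of [A] with
    value 1 at [x]; [injective_extension] says that the left kernel is zero. *)
Lemma dim_corner_ge i j x : injective_rmod (P i) -> socle_generator i x ->
  (\dim (corner j i) <= \dim (corner i j))%N.
Proof.
move=> Pi sx; have [x0 ix xi xr xs] := sx.
apply: (@dim_pairing _ _ _ _ _ (fun v u => coord [tuple x] ord0 (u * v))).
- by move=> w c u u'; rewrite mulrDr -scalerAr linearP.
- by move=> w c u u'; rewrite mulrDl -scalerAl linearP.
move=> v /cornerP[jv vi] v0; have [u iu uv] := injective_extension Pi sx v0 vi.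
exists (e i * u * e j); first exact: corner_mem.
rewrite iu -mulrA jv uv.
rewrite -[X in coord _ _ X]/([tuple x]`_(ord0 : 'I_1)) coord_free ?eqxx ?oner_neq0 //.
by rewrite seq1_free.
Qed.

(** * Standard modules and standard filtrations *)

Variable Delta : 'I_n -> rmod A.
Local Notation delta_above i :=
  (fun M => exists2 j : 'I_n, (i < j)%N & rmod_iso M (Delta j)).
Hypothesis P_filt : forall i, surjects_with_kernel (P i) (Delta i) (delta_above i).
Hypothesis Delta_filt : forall i, surjects_with_kernel (Delta i) (L i)
  (fun M => exists2 j : 'I_n, (j < i)%N & rmod_iso M (L j)).

Local Notation d i j := (dimE (Delta i) (e j)).

Lemma dimE_Delta i j : (i <= j)%N -> d i j = (i == j).
Proof.
move=> ij; have [Z [f [g [fg Zf]]]] := Delta_filt i.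
rewrite (dimE_exact (e_idem j) fg) dimE_simple.
suff -> : dimE Z (e j) = 0%N by [].
elim: Zf {f g fg} => [M M0|M' M M'' f g fg _ IH [l li iso]].
  exact: dimE_zero.
rewrite (dimE_exact (e_idem j) fg) IH (dimE_iso _ iso) dimE_simple.
by case: eqP => // lj; move: li; rewrite lj ltnNge ij.
Qed.

Lemma filtered_dimE i M : filtered (delta_above i) M ->
  exists u : 'I_n -> nat, (forall l : 'I_n, (l <= i)%N -> u l = 0%N) /\
    forall j, dimE M (e j) = (\sum_l u l * d l j)%N.
Proof.
elim=> [{}M M0|M' {}M M'' f g fg _ [u [u0 uE]] [l il iso]].
  exists (fun=> 0%N); split=> // j; rewrite dimE_zero // big1 // => l _; exact: mul0n.
exists (fun m => u m + (m == l))%N; split=> [m mi|j].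
  rewrite u0 //; case: eqP => // ml; move: il; by rewrite -ml ltnNge mi.
rewrite (dimE_exact (e_idem j) fg) (dimE_iso _ iso) uE.
under [RHS]eq_bigr do rewrite mulnDl.
rewrite big_split; congr (_ + _)%N; rewrite (bigD1 l) //= eqxx mul1n.
by rewrite big1 ?addn0 // => m /negbTE->.
Qed.

(** The matrix [d] is unitriangular by [dimE_Delta]; the induction descends from the largest
    index. *)
Lemma Delta_coef_inj (u v : 'I_n -> nat) :
  (forall j, \sum_l u l * d l j = \sum_l v l * d l j)%N -> u =1 v.
Proof.
move=> E; suff H m k : (n - k <= m)%N -> u k = v k by move=> k; apply: (H n); exact: leq_subr.
elim: m k => [|m IH] k; first by rewrite leqn0 subn_eq0 leqNgt ltn_ord.
move=> km; have := E k; rewrite (bigD1 k) //= [RHS](bigD1 k) //= dimE_Delta // eqxx !muln1.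
rewrite (eq_bigr (fun l => v l * d l k)%N); first exact: addIn.
move=> l lk; have [lek|ltk] := leqP l k.
  by rewrite dimE_Delta // (negbTE lk) !muln0.
rewrite (IH l) //; apply: leq_trans (_ : n - k.+1 <= m)%N; first exact: leq_sub2l.
by rewrite subnS -ltnS prednK ?subn_gt0.
Qed.

(** The smallest index occurring in the standard multiplicities of [P k] is [k] itself. *)
Lemma dimE_proj_inj i i' :
  (forall j, dimE (P i) (e j) = dimE (P i') (e j)) -> i = i'.
Proof.
have coef k : exists u : 'I_n -> nat, [/\ u k = 1%N, forall l : 'I_n, (l < k)%N -> u l = 0%N &
    forall j, dimE (P k) (e j) = (\sum_l u l * d l j)%N].
  have [Z [f [g [fg Zf]]]] := P_filt k; have [u [u0 uE]] := filtered_dimE Zf.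
  exists (fun m => u m + (m == k))%N; split=> [|l lk|j].
  - by rewrite u0 ?eqxx.
  - by rewrite u0 ?(ltnW lk) //; case: eqP lk => // ->; rewrite ltnn.
  rewrite (dimE_exact (e_idem j) fg) uE.
  under [RHS]eq_bigr do rewrite mulnDl.
  rewrite big_split; congr (_ + _)%N; rewrite (bigD1 k) //= eqxx mul1n.
  by rewrite big1 ?addn0 // => m /negbTE->.
have [u [uk ul uE]] := coef i; have [v [vk vl vE]] := coef i'.
move=> E; have uv : u =1 v by apply: Delta_coef_inj => j; rewrite -uE -vE.
apply/val_inj/eqP; rewrite /= eqn_leq; apply/andP; split; rewrite leqNgt; apply/negP => lt.
  by move: vk; rewrite -uv ul.
by move: uk; rewrite uv vl.
Qed.

(** [P i] is isomorphic to some [D (P j)], which has the multiplicities of [P j], so [i = j]. *)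
Lemma injective_proj_socle i : injective_rmod (P i) -> exists x, socle_generator i x.
Proof.
move=> Pi; have [j iso] := injective_proj_dual Pi.
apply: dual_proj_iso_socle; suff {1}-> : i = j by [].
apply: dimE_proj_inj => k; rewrite -(dimE_iso _ iso).
by rewrite (dual_dimE eta_bij eta_nat D_simple).
Qed.

Lemma Delta_hom_zero l M (h : rhom (Delta l) M) :
  (forall y : M, ract y (e l) = 0) -> forall x, h x = 0.
Proof.
have [_ [_ [q [[_ _ /surjP qs] _]]]] := P_filt l.
have [g [_ gl gE]] := exists_generator l.
by move=> Ml x; have [y <-] := qs x; rewrite (gE y) !rfunP -gl !rfunP Ml ract0l.
Qed.

Lemma filtered_hom_zero l Z M (h : rhom Z M) : filtered (delta_above l) Z ->
  (forall m : 'I_n, (l < m)%N -> forall y : M, ract y (e m) = 0) -> forall z, h z = 0.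
Proof.
move=> Zf Ml; elim: Zf h => [{}Z Z0|Z' {}Z Z'' f g [_ fg gs] _ IH [m lm iso]] h z.
  by have /fullv0P/(_ z) -> := Z0; rewrite linear0.
have [t [s st ts]] := iso_sym iso.
have [//|h' <-] := @factor_surj _ _ _ _ _ g h gs.
  rewrite -fg; apply/subvP => _ /memv_imgP[y _ ->].
  by rewrite memv_ker -rcompE IH.
rewrite rcompE; have -> : g z = t (s (g z)) by rewrite ts.
by rewrite -rcompE Delta_hom_zero //; apply: Ml.
Qed.

(** [Delta l] is projective relative to modules without factors [L m], [m > l]: the lift of [P l] to
    [M] kills the kernel onto [Delta l], which is filtered by such [Delta m]. *)
Lemma Delta_split l M (g : rhom M (Delta l)) : surjective_rhom g ->
  (forall m : 'I_n, (l < m)%N -> forall y : M, ract y (e m) = 0) ->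
  exists s : rhom (Delta l) M, rcomp g s = rid (Delta l).
Proof.
move=> gs Ml; have [Z [i [q [[_ iq qs] Zf]]]] := P_filt l.
have [Pp _] := P_cover l; have [h gh] := Pp _ _ g q gs.
have [|s sq] := @factor_surj _ _ _ _ _ q h qs.
  rewrite -iq; apply/subvP => _ /memv_imgP[y _ ->].
  by rewrite memv_ker -rcompE (filtered_hom_zero _ Zf Ml).
exists s; apply: rhom_eq => x; have /surjP/(_ x)[y <-] := qs.
by rewrite rcompE -[s _]rcompE sq -rcompE gh ridE.
Qed.

Definition uniform_rmod M : Prop := forall U V : {vspace M},
  submodule U -> submodule V -> (U :&: V)%VS = 0%VS -> U = 0%VS \/ V = 0%VS.

Lemma uniform_sub M M' (f : rhom M' M) :
  injective f -> uniform_rmod M -> uniform_rmod M'.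
Proof.
move=> /lker0P fi Mu U V hU hV UV.
have [||| /eqP|/eqP] := Mu (f @: U)%VS (f @: V)%VS; [exact: submodule_img..| | |].
- by rewrite -lker0_img_cap // UV limg0.
- by rewrite -(limg0 f) eq_limg_ker0 // => /eqP; left.
- by rewrite -(limg0 f) eq_limg_ker0 // => /eqP; right.
Qed.

(* The induction climbs the filtration: a subquotient Delta_l with l at least *)
(* all previous indices splits off, which uniformity forbids above the bottom. *)
Lemma uniform_filtered i M : filtered (delta_above i) M -> uniform_rmod M ->
  (fullv : {vspace M}) <> 0%VS ->
  exists (k : 'I_n) (h : rhom (Delta k) M) (u : 'I_n -> nat),
  [/\ (i < k)%N, injective h, u k = 1%N,
      forall l : 'I_n, (l <= i)%N || (k < l)%N -> u l = 0%N &
      forall j, dimE M (e j) = (\sum_l u l * d l j)%N].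
Proof.
elim=> [{}M M0 //|M' {}M M'' f g [fi fg gs] _ IH [l il [t bt]]] Mu nM.
have iso : rmod_iso M'' (Delta l) by exists t.
have tgs : surjective_rhom (rcomp t g).
  apply/surjP => y; have /surjP/(_ y)[z <-] := bij_surj bt.
  by have /surjP/(_ z)[x <-] := gs; exists x; rewrite rcompE.
have dE j : dimE M (e j) = (dimE M' (e j) + d l j)%N.
  by rewrite (dimE_exact (e_idem j) (And3 fi fg gs)) (dimE_iso _ iso).
have sumD (u : 'I_n -> nat) j :
    (\sum_m (u m + (m == l)) * d m j = (\sum_m u m * d m j) + d l j)%N.
  under eq_bigr do rewrite mulnDl.
  rewrite big_split; congr (_ + _)%N; rewrite (bigD1 l) //= eqxx mul1n.
  by rewrite big1 ?addn0 // => m /negbTE->.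
(* At the bottom of the filtration [M] itself is [Delta l]. *)
have [/eqP M'0|/eqP nM'] := boolP ((fullv : {vspace M'}) == 0%VS).
  have bg : bijective (rcomp t g).
    apply: inj_surj_bij => // x y; rewrite !rcompE => /(bij_inj bt) E.
    apply/eqP; rewrite -subr_eq0 -memv0 -(limg0 f) -M'0 fg memv_ker linearB /= E.
    by rewrite subrr.
  have [h1 bh1] := iso_sym (ex_intro _ _ bg : rmod_iso M (Delta l)).
  exists l, h1, (fun m : 'I_n => 0 + (m == l))%N; split=> //.
  - exact: bij_inj bh1.
  - by rewrite eqxx.
  - move=> m; case: eqP => // ->; by rewrite ltnn orbF leqNgt il.
  move=> j; rewrite dE dimE_zero // sumD big1 // => m _; exact: mul0n.
have [k [h [u [ik hi uk u0 uE]]]] := IH (uniform_sub fi Mu) nM'.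
(* If [k <= l], no [L m] with [m > l] occurs in [M], so [Delta l] splits off and meets the nonzero
   image of [f] trivially, a contradiction. If [l < k], the embedding of [Delta k] and its
   multiplicity 1 persist. *)
have [kl|lk] := leqP k l.
  have Ml (m : 'I_n) : (l < m)%N -> forall y : M, ract y (e m) = 0.
    move=> lm; apply/dimE_eq0; rewrite dE uE dimE_Delta ?(ltnW lm) //.
    have -> : (l == m) = false by apply/negbTE; rewrite -val_eqE neq_ltn lm.
    rewrite addn0 big1 // => m' _; have [m'm|mm'] := ltnP m' m.
      rewrite dimE_Delta ?(ltnW m'm) // -val_eqE /= (ltn_eqF m'm) muln0 //.
    by rewrite u0 // (leq_ltn_trans kl (leq_trans lm mm')) orbT.
  have [s sE] := Delta_split tgs Ml.
  have [||| /eqP f0|/eqP s0] := Mu (limg f) (limg s).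
  - exact/submodule_img/submodule_full.
  - exact/submodule_img/submodule_full.
  - apply/eqP; rewrite -subv0; apply/subvP => x /memv_capP[].
    rewrite fg memv_ker => /eqP gx /memv_imgP[y _ xy].
    have : rcomp (rcomp t g) s y = y by rewrite sE ridE.
    by rewrite !rcompE -xy gx linear0 xy => <-; rewrite linear0 mem0v.
  - case: nM'; apply/fullv0P => y; apply: fi; rewrite linear0; apply/eqP.
    by rewrite -memv0 -(eqP f0) memv_img ?memvf.
  have dl0 : d l l = 0%N.
    apply/eqP/dimE_eq0 => y; rewrite -[y]ridE -sE rcompE.
    have -> : s y = 0 by apply/eqP; rewrite -memv0 -(eqP s0) memv_img ?memvf.
    by rewrite linear0 ract0l.
  by move: (dimE_Delta (leqnn l)); rewrite dl0 eqxx.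
exists k, (rcomp f h), (fun m => u m + (m == l))%N; split=> //.
- by move=> x y; rewrite !rcompE => /fi/hi.
- by rewrite uk; case: eqP lk => // ->; rewrite ltnn.
- move=> m mik; rewrite u0 //; case: eqP mik => // ->.
  by rewrite leqNgt il /= ltnNge (ltnW lk).
- by move=> j; rewrite dE uE sumD.
Qed.

Lemma socle_uniform i x : socle_generator i x -> uniform_rmod (P i).
Proof.
move=> [x0 ix xi xr xs] U V hU hV UV.
have [y yx] := iota_onto ix.
have yW (W : {vspace P i}) : submodule W -> W <> 0%VS -> y \in W.
  move=> hW /eqP nW; have [|a ua] := xs (iota i (vpick W)) _ (iotaE _).
    by rewrite -(linear0 (iota i)) (inj_eq (@iota_inj i)) vpick0.
  suff -> : y = ract (vpick W) a by apply/hW/memv_pick.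
  by apply: (@iota_inj i); rewrite iota_ract ua.
have [->|/eqP nU] := eqVneq U 0%VS; [by left|right].
have [//|/eqP nV] := eqVneq V 0%VS.
case/negP: x0; rewrite -yx -(linear0 (iota i)) (inj_eq (@iota_inj i)).
by rewrite -memv0 -UV memv_cap !yW.
Qed.

(** The analogue of [socle_generator]: the socle of [Delta k] is simple, essential and isomorphic to
    [L i]. *)
Definition Delta_socle k i : Prop := exists y : Delta k,
  [/\ y != 0, ract y (e i) = y, forall r, in_radical r -> ract y r = 0 &
      forall z, z != 0 -> exists a, ract z a = y].

Lemma Delta_socle_unique k i j : Delta_socle k i -> Delta_socle k j -> i = j.
Proof.
move=> [y [y0 yi yr ys]] [z [z0 zj zr zs]]; apply/eqP; apply: contraT => ij.
have [a za] := ys z z0; have [c zc] := ract_line a zj zr.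
case/negP: y0; rewrite -yi -za zc -zj -ractZl -ractM e_orth ?ract0r //.
by rewrite eq_sym.
Qed.

Lemma sub_Delta_socle k i x (f : rhom (Delta k) (P i)) :
  injective f -> socle_generator i x -> Delta_socle k i.
Proof.
move=> fi [x0 ix xi xr xs].
have fi' : injective (fun z => iota i (f z)) by move=> z z' /iota_inj/fi.
have f0 : iota i (f 0) = 0 by rewrite !linear0.
have main z : z != 0 -> exists a, iota i (f (ract z a)) = x.
  move=> z0; have [|a za] := xs (iota i (f z)) _ (iotaE _).
    by rewrite -f0 (inj_eq fi').
  by exists a; rewrite rfunP iota_ract.
have [z z0] : exists z : Delta k, z != 0.
  apply: not_fullv0 => /(dimE_zero (e k)).
  by rewrite dimE_Delta // eqxx.
have [a zx] := main z z0; exists (ract z a); split.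
- by rewrite -(inj_eq fi') f0 zx.
- by apply: fi'; rewrite rfunP iota_ract zx.
- by move=> r hr; apply: fi'; rewrite rfunP iota_ract zx f0 xr.
by move=> w /main[b wx]; exists b; apply: fi'; rewrite zx.
Qed.

(** No index exceeds the last one, so the kernel onto [Delta i] contributes nothing. *)
Lemma dim_corner_last i : i.+1 = n -> forall j, \dim (corner i j) = d i j.
Proof.
move=> il j; rewrite -dimE_proj; have [Z [f [g [fg Zf]]]] := P_filt i.
rewrite (dimE_exact (e_idem j) fg).
have [u [u0 ->]] := filtered_dimE Zf.
by rewrite big1 // => l _; rewrite u0 // -ltnS il.
Qed.

Lemma last_not_injective i : connected_algebra A -> (1 < n)%N -> i.+1 = n ->
  ~ injective_rmod (P i).
Proof.
move=> conn n1 il Pi; have [x sx] := injective_proj_socle Pi.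
have d1 : \dim (corner i i) = 1%N by rewrite dim_corner_last // dimE_Delta // eqxx.
have := simple_injective_central Pi sx d1 conn (Ordinal (ltnW n1)).
by move/(congr1 val) => /= i0; move: n1; rewrite -il -i0.
Qed.

(** * The Cartan numbers *)

Hypothesis A_conn : connected_algebra A.
Hypothesis P_inj : forall i, (i.+1 < n)%N -> injective_rmod (P i).

Lemma proj_kernel i : (i.+1 < n)%N ->
  exists (k : 'I_n) (u : 'I_n -> nat),
  [/\ (i < k)%N, Delta_socle k i, u k = 1%N,
      forall l : 'I_n, (l <= i)%N || (k < l)%N -> u l = 0%N &
      forall j, dimE (P i) (e j) = (\sum_l u l * d l j + d i j)%N].
Proof.
move=> iltn; have Pi := P_inj iltn; have [x sx] := injective_proj_socle Pi.
have [Z [f [g [fg Zf]]]] := P_filt i; have [fi _ _] := fg.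
have [|k [h [u [ik hi uk u0 uE]]]] := uniform_filtered Zf (uniform_sub fi (socle_uniform sx)).
  (* A zero kernel would make the corner at [i] a line, and [simple_injective_central] would
     identify [i] with its successor. *)
  move=> Z0; have d1 : \dim (corner i i) = 1%N.
    by rewrite -dimE_proj (dimE_exact (e_idem i) fg) dimE_zero // dimE_Delta // eqxx.
  have := simple_injective_central Pi sx d1 A_conn (Ordinal iltn).
  by move/(congr1 val) => /= /eqP; rewrite (gtn_eqF (ltnSn i)).
exists k, u; split=> // [|j].
  apply: (@sub_Delta_socle _ _ _ (rcomp f h)) sx.
  by move=> z z'; rewrite !rcompE => /fi/hi.
by rewrite (dimE_exact (e_idem j) fg) uE.
Qed.

(** [k j] is the standard module at the bottom of the kernel for [j]. Its socle determines [j], so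
    [k] is injective with [k j > j], which forces the successor. As no index lies strictly between,
    the kernel has the multiplicities of [Delta i']. *)
Lemma proj_next i i' : i' = i.+1 :> nat ->
  Delta_socle i' i /\ forall j, \dim (corner i j) = (d i j + d i' j)%N.
Proof.
have kn (l : 'I_n) m : (m < l)%N -> (m.+1 < n)%N by move=> ml; apply: leq_ltn_trans (ltn_ord l).
have /choice[k kP] j : exists k : 'I_n, (j.+1 < n)%N -> exists u : 'I_n -> nat,
  [/\ (j < k)%N, Delta_socle k j, u k = 1%N,
      forall l : 'I_n, (l <= j)%N || (k < l)%N -> u l = 0%N &
      forall m, dimE (P j) (e m) = (\sum_l u l * d l m + d j m)%N].
  have [jn|jn] := boolP (j.+1 < n)%N; last by exists j.
  by have [k [u H]] := proj_kernel jn; exists k => _; exists u.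
(* Downward induction: the values above j.+1 are already taken by larger j. *)
have kE m j : (n - j <= m)%N -> (j.+1 < n)%N -> k j = j.+1 :> nat.
  elim: m j => [|m IH] j; first by rewrite leqn0 subn_eq0 leqNgt ltn_ord.
  move=> jm jn; have [u [jk sk _ _ _]] := kP j jn.
  apply/eqP; rewrite eqn_leq jk andbT leqNgt; apply/negP => lt.
  have k0 : (k j).-1.+1 = k j by rewrite prednK // (leq_ltn_trans _ lt).
  have ltn2 : ((k j).-1 < n)%N by rewrite k0 ltnW // (leq_ltn_trans _ (ltn_ord (k j))) // -k0.
  (* [j2] is the predecessor of [k j]; by induction [k j2 = k j], although [j < j2]. *)
  pose j2 := Ordinal (leq_ltn_trans (leq_pred _) (ltn_ord (k j))).
  have j2n : (j2.+1 < n)%N by rewrite /= k0.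
  have jj2 : (j < j2)%N by rewrite -ltnS /= k0.
  have kj2 : k j2 = k j.
    apply: val_inj; rewrite /= IH //= -ltnS; apply: leq_trans jm.
    by rewrite ltn_sub2l // (ltn_trans (ltnSn j)).
  have [_ [_ sk2 _ _ _]] := kP j2 j2n; rewrite kj2 in sk2.
  by move: jj2; rewrite (Delta_socle_unique sk sk2) ltnn.
move=> ii'; have iltn : (i.+1 < n)%N by rewrite -ii'.
have ki : k i = i' by apply: val_inj; rewrite /= (kE n) // leq_subr.
have [u [ik sk uk u0 uE]] := kP i iltn; rewrite ki in sk uk u0.
split=> // j; rewrite -dimE_proj uE addnC; congr (_ + _)%N.
rewrite (bigD1 i') //= uk mul1n big1 ?addn0 // => l li'.
by rewrite u0 //; move: li'; rewrite -val_eqE /= neq_ltn {1}ii' ltnS.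
Qed.

(** For [j < k], [d k j] is at most the dimension of [corner k j], hence of [corner j k], which is 1
    or 0 according as [k] is the successor of [j]. In the first case the socle of [Delta k] shows
    that [L j] does occur. *)
Lemma Delta_dim k j : d k j = ((j == k) + (j.+1 == k))%N.
Proof.
have [kj|jk] := leqP k j.
  by rewrite dimE_Delta // eq_sym (gtn_eqF (kj : (k < j.+1)%N)) addn0.
have jn : (j.+1 < n)%N by apply: leq_ltn_trans (ltn_ord k).
have [_ dj] := @proj_next j (Ordinal jn) erefl.
have [x sx] := injective_proj_socle (P_inj jn).
have djk : \dim (corner j k) = (j.+1 == k).
  rewrite dj dimE_Delta ?(ltnW jk) // dimE_Delta // -!val_eqE /=.
  by rewrite (ltn_eqF jk).
have le1 : (d k j <= (j.+1 == k))%N.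
  rewrite -djk; apply: leq_trans (dim_corner_ge k (P_inj jn) sx).
  have [kn|kn] := boolP (k.+1 < n)%N.
    by have [_ ->] := @proj_next k (Ordinal kn) erefl; exact: leq_addr.
  rewrite dim_corner_last //; apply/eqP; rewrite eqn_leq ltn_ord /=.
  by rewrite leqNgt.
have -> : (j == k) = false by rewrite -val_eqE /= (ltn_eqF jk).
apply/eqP; rewrite add0n eqn_leq le1 /=; case: eqP => // /esym jk1.
have [[y [y0 yj _ _]] _] := @proj_next j k jk1.
rewrite lt0n; apply: contra y0 => /dimE_eq0/(_ y).
by rewrite yj => /eqP.
Qed.

(** The Cartan matrix of [B_n]: 2 on the diagonal, but 1 at the last vertex, and 1 between
    neighbours. *)
Lemma corner_dim i j : \dim (corner i j) =
  ((i == j) + (j.+1 == i) + (i.+1 < n) * ((i == j) + (i.+1 == j)))%N.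
Proof.
have [iltn|igen] := boolP (i.+1 < n)%N.
  have [_ ->] := @proj_next i (Ordinal iltn) erefl; rewrite !Delta_dim mul1n.
  by rewrite -!val_eqE /= eqSS [j == i :> nat]eq_sym [j == i.+1 :> nat]eq_sym [X in (_ + X)%N]addnC.
rewrite mul0n addn0 dim_corner_last ?Delta_dim //; first by rewrite eq_sym.
by apply/eqP; rewrite eqn_leq ltn_ord leqNgt.
Qed.

(** * Arrows satisfying the relations of B_n *)

Lemma radical_idem0 i c : in_radical (c *: e i) -> c = 0.
Proof.
have [/not_fullv0[v v0] _] := L_simple i.
move=> /(_ i v)/eqP; rewrite ractZr simple_ract_id scaler_eq0 (negbTE v0) orbF.
by move/eqP.
Qed.

Lemma radicalB a b : in_radical a -> in_radical b -> in_radical (a - b).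
Proof. by move=> ha hb i x; rewrite ractBr ha hb subrr. Qed.

Lemma radicalZ c a : in_radical a -> in_radical (c *: a).
Proof. by move=> ha i x; rewrite ractZr ha scaler0. Qed.

Lemma corner_radical i j (a : A) : i != j -> a \in corner i j -> in_radical a.
Proof. by move=> ij /cornerP[ia aj]; apply: radical_offdiag ij ia aj. Qed.

Lemma cornerM i j k (a b : A) : a \in corner i j -> b \in corner j k -> a * b \in corner i k.
Proof.
move=> /cornerP[ia _] /cornerP[_ bk]; apply/cornerP.
by rewrite mulrA ia -mulrA bk.
Qed.

Lemma diag_span i (w a : A) : (i.+1 < n)%N -> w \in corner i i -> w != 0 ->
  in_radical w -> a \in corner i i -> exists c d, a = c *: e i + d *: w.
Proof.
move=> iltn wi w0 wr ai.
have ei : e i \in corner i i by apply/cornerP; rewrite e_idem.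
have cap0 : (<[e i]> :&: <[w]> = 0)%VS.
  apply/eqP; rewrite -subv0; apply/subvP => _ /memv_capP[/vlineP[c ->] /vlineP[d cd]].
  by rewrite (@radical_idem0 i c) ?scale0r ?mem0v // cd; apply: radicalZ.
have E : corner i i = (<[e i]> + <[w]>)%VS.
  apply/esym/eqP; rewrite eqEdim subv_add -!memvE ei wi.
  rewrite dimv_disjoint_sum // !dim_vline w0 idem_neq0 corner_dim eqxx iltn.
  by rewrite (gtn_eqF (ltnSn i)).
move: ai; rewrite E => /memv_addP[_ /vlineP[c ->] [_ /vlineP[d ->] ->]].
by exists c, d.
Qed.

Lemma diag_radical i (w a : A) : (i.+1 < n)%N -> w \in corner i i -> w != 0 ->
  in_radical w -> a \in corner i i -> in_radical a -> exists d, a = d *: w.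
Proof.
move=> iltn wi w0 wr ai ar; have [c [d ad]] := diag_span iltn wi w0 wr ai.
exists d; rewrite ad (@radical_idem0 i c) ?scale0r ?add0r //.
have -> : c *: e i = a - d *: w by rewrite ad addrK.
by apply: radicalB ar _; apply: radicalZ.
Qed.

Lemma last_span i (a : A) : i.+1 = n -> a \in corner i i -> exists c, a = c *: e i.
Proof.
move=> il; apply: dim1_line; last exact: idem_neq0.
  by rewrite corner_dim il ltnn eqxx gtn_eqF // -il.
by apply/cornerP; rewrite e_idem.
Qed.

Lemma dim_corner_adj i j : (j == i.+1 :> nat) || (i == j.+1 :> nat) ->
  \dim (corner i j) = 1%N.
Proof.
rewrite corner_dim -!val_eqE /= => adj.
by have := ltn_ord i; have := ltn_ord j; lia.
Qed.

Lemma socle_radical i x : (i.+1 < n)%N -> socle_generator i x -> in_radical x.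
Proof.
move=> iltn [_ _ _ _ xs]; pose j := Ordinal iltn.
have ij : i != j by rewrite -val_eqE /= (ltn_eqF (ltnSn i)).
have u0 : vpick (corner i j) != 0.
  by rewrite vpick0 -dimv_eq0 dim_corner_adj //= eqxx.
have uij := memv_pick (corner i j).
have [|a <-] := xs _ u0; first by case/cornerP: uij.
exact/radicalMr/(corner_radical ij uij).
Qed.

Lemma basic_iso_B : (1 < n)%N -> iso_to_B A n.
Proof.
(* [o] reads naturals as indices, with default 0, so that arrows can be chosen by recursion on
   [nat]. *)
move=> n1; pose o (k : nat) : 'I_n := insubd (Ordinal (ltnW n1)) k.
have oE (k : nat) : (k < n)%N -> o k = k :> nat by move=> kn; rewrite /o val_insubd kn.
have ovK (i : 'I_n) : o i = i by apply: val_inj; rewrite /= oE.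
have /choice[x xP] i : exists x, (i.+1 < n)%N -> socle_generator i x.
  have [iltn|_] := boolP (i.+1 < n)%N; last by exists 0.
  by have [x sx] := injective_proj_socle (P_inj iltn); exists x.
have adjo (k : nat) : (k.+1 < n)%N -> (o k.+1 == (o k).+1 :> nat) by move=> kn; rewrite !oE // ltnW.
have neqo (k : nat) : (k.+1 < n)%N -> o k != o k.+1.
  by move=> kn; rewrite -val_eqE /= !oE ?(ltnW kn) // (ltn_eqF (ltnSn k)).
have next (k : nat) : (k.+1 < n)%N -> ((o k).+1 < n)%N by move=> kn; rewrite oE // ltnW.
pose B (k : nat) : A := vpick (corner (o k.+1) (o k)).
have Bin (k : nat) : B k \in corner (o k.+1) (o k) by exact: memv_pick.
have B0 (k : nat) : (k.+1 < n)%N -> B k != 0.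
  by move=> kn; rewrite vpick0 -dimv_eq0 dim_corner_adj // adjo ?orbT.
(* B k is an arrow k+1 -> k; the arrows up k : k -> k+1 are chosen one after  *)
(* the other, up k.+1 being scaled so that the two cycles at k+1 agree.       *)
have /choice[step stepP] (kw : nat * A) : exists a : A, (kw.1.+1 < n)%N ->
    kw.2 \in <[x (o kw.1)]>%VS -> a \in corner (o kw.1) (o kw.1.+1) /\ a * B kw.1 = kw.2.
  case: kw => k w /=; have [kn|_] := boolP (k.+1 < n)%N; last by exists 0.
  have [/vlineP[c ->]|_] := boolP (w \in <[x (o k)]>%VS); last by exists 0.
  have /cornerP[Bl Br] := Bin k.
  have [u iu uB] := injective_extension (P_inj (next k kn)) (xP _ (next k kn)) (B0 k kn) Br.
  exists (c *: (u * e (o k.+1))) => _ _; split.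
    by apply/memvZ/cornerP; rewrite mulrA iu -mulrA e_idem.
  by rewrite -scalerAl -mulrA Bl uB.
(* Radical elements of the diagonal corner at a vertex other than the last are multiples of the
   socle generator. *)
have Bux (k : nat) w : (k.+2 < n)%N -> w \in corner (o k) (o k.+1) -> B k * w \in <[x (o k.+1)]>%VS.
  move=> kn win; have [x0 ix xi _ _] := xP _ (next _ kn).
  have [|||||d ->] := @diag_radical (o k.+1) (x (o k.+1)) (B k * w) (next _ kn) => //.
  - exact/cornerP.
  - exact: (socle_radical (next _ kn) (xP _ (next _ kn))).
  - exact: cornerM (Bin k) win.
  - by apply/radicalMr/(corner_radical _ (Bin k)); rewrite eq_sym neqo ?(ltnW kn).
  by rewrite memvZ ?memv_line.
pose up := fix up (k : nat) := if k is k'.+1 then step (k, B k' * up k') else step (0%N, x (o 0)).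
have upS (k : nat) : up k.+1 = step (k.+1, B k * up k) by [].
have upP (k : nat) : (k.+1 < n)%N -> [/\ up k \in corner (o k) (o k.+1), up k * B k != 0 &
    up k * B k \in <[x (o k)]>%VS].
  elim: k => [|k IH] kn.
    have [xin ->] := stepP (0%N, x (o 0)) kn (memv_line _); split=> //; last exact: memv_line.
    by case: (xP _ (next _ kn)).
  have kn' := ltnW kn; have [uin nz _] := IH kn'.
  have [x0 ix xi xr xs] := xP _ (next _ kn).
  have up0 : up k != 0 by apply: contraNneq nz => ->; rewrite mul0r.
  (* The socle is essential, so [B k * a = x (o k.+1)] for some [a], which can be cut down to a
     multiple of [up k]. *)
  have Bu0 : B k * up k != 0.
    have /cornerP[Bl Br] := Bin k; have [a Ba] := xs _ (B0 k kn') Bl.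
    have tin : e (o k) * a * e (o k.+1) \in corner (o k) (o k.+1) by exact: corner_mem.
    have d1 : \dim (corner (o k) (o k.+1)) = 1%N by rewrite dim_corner_adj // adjo.
    have [c tc] := dim1_line d1 uin up0 tin.
    apply: contraNneq x0 => Bu; rewrite -xi -Ba -{1}Br -2!mulrA [e _ * _]mulrA tc.
    by rewrite -scalerAr Bu scaler0.
  have [] := stepP (k.+1, B k * up k) kn (Bux k _ kn uin).
  by rewrite -upS /= => ? ->; split=> //; apply: Bux.
have upB (k : nat) : (k.+2 < n)%N -> up k.+1 * B k.+1 = B k * up k.
  move=> kn; have [uin _ _] := upP k (ltnW kn).
  by have [] := stepP (k.+1, B k * up k) kn (Bux k _ kn uin).
pose adj (i j : 'I_n) := (j == i.+1 :> nat) || (i == j.+1 :> nat).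
pose al (i j : 'I_n) := if j == i.+1 :> nat then up i else B j.
pose z (i : 'I_n) := if (i.+1 < n)%N then up i * B i else 0.
have oS (i j : 'I_n) : j = i.+1 :> nat -> o i.+1 = j by move=> <-; exact: ovK.
have lt_of (i j : 'I_n) : j = i.+1 :> nat -> (i.+1 < n)%N by move=> <-.
have adj_sym i j : adj i j -> adj j i by rewrite /adj orbC.
have adj_neq i j : adj i j -> i != j by rewrite /adj -val_eqE /=; lia.
have alin i j : adj i j -> al i j \in corner i j.
  rewrite /adj /al; case: (eqVneq (j : nat) i.+1) => [ij _|_ /eqP ij].
    by have [+ _ _] := upP i (lt_of _ _ ij); rewrite ovK (oS i j ij).
  by have := Bin j; rewrite ovK (oS j i ij).
have al0 i j : adj i j -> al i j != 0.
  rewrite /adj /al; case: (eqVneq (j : nat) i.+1) => [ij _|_ /eqP ij].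
    have [_ + _] := upP i (lt_of _ _ ij).
    by apply: contraNneq => ->; rewrite mul0r.
  exact: B0 (lt_of _ _ ij).
have alrad i j : adj i j -> in_radical (al i j).
  by move=> ij; apply: corner_radical (adj_neq i j ij) (alin i j ij).
have zx (i : 'I_n) : (i.+1 < n)%N -> z i \in <[x i]>%VS /\ z i != 0.
  by move=> kn; rewrite /z kn; have [_ ? +] := upP i kn; rewrite ovK.
have al_cycle i j : adj i j -> al i j * al j i = z i.
  move=> ij; have zi : al i j * al j i \in corner i i.
    by apply: cornerM (alin _ _ (adj_sym _ _ ij)); apply: alin.
  have zr : in_radical (al i j * al j i) by apply/radicalMr/alrad.
  move: (ij); rewrite /adj /z => /orP[/eqP E|/eqP E].
    by rewrite (lt_of _ _ E) /al E eqxx (ltn_eqF (ltnW (ltnSn _))).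
  have [kn|kn] := boolP (i.+1 < n)%N.
    rewrite /al E eqxx (ltn_eqF (ltnW (ltnSn _))) upB //.
    by rewrite -E.
  (* At the last vertex the corner is the line of [e i], whose only radical element is 0. *)
  have [|c cE] := @last_span i _ _ zi; first by apply/eqP; rewrite eqn_leq ltn_ord leqNgt.
  by move: zr; rewrite cE => /radical_idem0 ->; rewrite scale0r.
apply: (@iso_to_B_of_generators K A n e al z) => //.
- by move=> i j /alin/cornerP[].
- by move=> i j /alin/cornerP[].
- move=> i j k ij jk ik; have := cornerM (alin _ _ ij) (alin _ _ jk).
  (* Here [i] and [k] are two apart, where the Cartan number is 0. *)
  have -> : corner i k = 0%VS; last by rewrite memv0 => /eqP.
  apply/eqP; rewrite -dimv_eq0 corner_dim -!val_eqE /=.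
  by move: ij jk ik; rewrite /adj -val_eqE /=; lia.
- move=> i j ij; have [kn|kn] := boolP (i.+1 < n)%N; last by rewrite /z (negbTE kn) mul0r.
  have [/vlineP[c ->] _] := zx i kn; have [_ _ _ xr _] := xP i kn.
  by rewrite -scalerAl xr ?scaler0 //; apply: alrad.
- by move=> i il; rewrite /z il ltnn.
- move=> a i j; have := corner_mem i j a.
  have [<-|ij] := eqVneq i j => ain.
    have [kn|kn] := boolP (i.+1 < n)%N; last first.
      have [|c ->] := @last_span i _ _ ain; first by apply/eqP; rewrite eqn_leq ltn_ord leqNgt.
      by exists c, 0; rewrite scale0r addr0.
    have [zxi z0] := zx i kn; pose j' := Ordinal kn.
    have ij' : adj i j' by rewrite /adj eqxx.
    apply: diag_span => //; rewrite -(al_cycle _ _ ij').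
      by apply: cornerM (alin _ _ (adj_sym _ _ ij')); apply: alin.
    exact/radicalMr/alrad.
  case: ifP => [aij|naij].
    have [c ->] := dim1_line (dim_corner_adj aij) (alin _ _ aij) (al0 _ _ aij) ain.
    by exists c, 0; rewrite scale0r addr0.
  exists 0, 0; rewrite !scale0r addr0; apply/eqP; rewrite -memv0.
  suff <- : corner i j = 0%VS by [].
  apply/eqP; rewrite -dimv_eq0 corner_dim -!val_eqE /=.
  by move: ij naij; rewrite -val_eqE /=; lia.
- exact: idem_neq0.
- by move=> i /zx[].
Qed.

End BasicStructure.

(** * Counting the injective projectives *)

Lemma injective_iso (K : fieldType) (A : falgType K) (M N : rmod A) :
  rmod_iso M N -> injective_rmod M -> injective_rmod N.
Proof.
case=> t bt Mi X Y g f gi; have [s [ts _]] := bij_inverse bt.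
have [h hg] := Mi X Y g (rcomp s f) gi; exists (rcomp t h).
by apply: rhom_eq => x; rewrite !rcompE -[h _]rcompE hg rcompE -[t _]rcompE ts ridE.
Qed.

(** Over scalars every linear map is a homomorphism, and linear maps extend. *)
Lemma scalar_algebra_injective (K : fieldType) (A : falgType K) (N : rmod A) :
  (forall a : A, exists c, a = c *: 1) -> injective_rmod N.
Proof.
move=> A1 M M' g f /lker0P k0.
have hP (x : M') a : (f \o g^-1)%VF (ract x a) = ract ((f \o g^-1)%VF x) a.
  by have [c ->] := A1 a; rewrite !ractZr !ract1 linearZ.
exists (RHom hP); apply: rhom_eq => x.
by rewrite rcompE /= comp_lfunE lker0_lfunK.
Qed.

Theorem theorem1 (K : closedFieldType) (n : nat) (n_gt0 : (0 < n)%N)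
    (A : falgType K) (A_basic : basic_algebra A) (A_conn : connected_algebra A)
    (L : 'I_n -> rmod A) (L_simples : representatives (@simple_rmod K A) L)
    (A_qh : quasi_hereditary L)
    (proj_inj : exists Q : 'I_n.-1 -> rmod A,
       representatives
         (fun M => [/\ indecomposable M, projective_rmod M & injective_rmod M])
         Q)
    (A_duality : has_simple_preserving_duality A) :
  (1 < n)%N /\ iso_to_B A n.
Proof.
have [P [Delta qh]] := A_qh.
have P_cover i : projective_cover (P i) (L i) by case: (qh i).
have P_filt i := let: And3 _ h _ := qh i in h.
have Delta_filt i := let: And3 _ _ h := qh i in h.
have [D [[eta [eta_bij eta_nat]] D_simple]] := A_duality.
have [e [iota [e_sum e_idem e_orth iota_inj iotaP]]] :=
  basic_idempotents A_basic L_simples P_cover.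
have [Q [QP Q_inj Q_surj]] := proj_inj.
have L_simple i : simple_rmod (L i) by case: L_simples => + _ _; apply.
have P_ind i : indecomposable (P i).
  by have [_ [p [ps small]]] := P_cover i; apply: cover_indecomposable (L_simple i) ps small.
pose l : 'I_n := Ordinal (ltac:(by rewrite prednK) : (n.-1 < n)%N).
have lE : l.+1 = n by rewrite /= prednK.
(* For n = 1 all elements of [A] are scalars, so [P l] is injective, yet ['I_n.-1] is empty. *)
have n_gt1 : (1 < n)%N.
  rewrite ltnNge; apply/negP => n1.
  have i0 (i : 'I_n) : i = l by apply: val_inj => /=; have := ltn_ord i; lia.
  have el : e l = 1.
    by rewrite -e_sum (bigD1 l) //= big1 ?addr0 // => i; rewrite (i0 i) eqxx.
  have P_inj (i : 'I_n) : (i.+1 < n)%N -> injective_rmod (P i) by lia.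
  have [k _] : exists k : 'I_n.-1, rmod_iso (P l) (Q k).
    apply: Q_surj; split=> //; first by case: (P_cover l).
    apply: scalar_algebra_injective => a.
    have al : a \in corner e l l.
      by apply/(cornerP e_idem); rewrite el mul1r mulr1.
    have [c ->] := last_span L_simples P_cover e_sum e_idem e_orth iota_inj iotaP
      eta_bij eta_nat D_simple P_filt Delta_filt A_conn P_inj lE al.
    by exists c; rewrite el.
  by case: k => k; lia.
have l_not_inj := last_not_injective L_simples P_cover e_sum e_idem e_orth iota_inj iotaP
  eta_bij eta_nat D_simple P_filt Delta_filt A_conn n_gt1 lE.
have /choice[k kP] j : exists i, rmod_iso (P i) (Q j).
  have [Qi Qp _] := QP j; have [S [q [Ss qs]]] := simple_quotient Qi.1.
  have [_ _ /(_ S Ss)[i [t bt]]] := L_simples; exists i.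
  have [Pp [p [ps small]]] := P_cover i.
  apply: (cover_indec_iso (q := rcomp t q) (L_simple i) ps small Pp Qp Qi).
  apply/surjP => y; have /surjP/(_ y)[z <-] := bij_surj bt.
  by have /surjP/(_ z)[x <-] := qs; exists x; rewrite rcompE.
have kI : injective k.
  move=> j j' E; apply: Q_inj; apply: iso_trans (iso_sym (kP j)) _.
  by rewrite E; apply: kP.
have Pk_inj j : injective_rmod (P (k j)).
  by have [_ _ Qinj] := QP j; apply: injective_iso (iso_sym (kP j)) Qinj.
(* The n - 1 distinct indices [k j] avoid [l], so they exhaust the other indices. *)
have imk : [set k j | j in 'I_n.-1] = [set: 'I_n] :\ l.
  apply/eqP; rewrite eqEcard; apply/andP; split.
    apply/subsetP => _ /imsetP[j _ ->]; rewrite !inE andbT; apply/eqP => E.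
    by apply: l_not_inj; rewrite -E; apply: Pk_inj.
  rewrite card_imset // card_ord.
  have := cardsD1 l [set: 'I_n].
  by rewrite inE cardsT card_ord add1n => /(congr1 predn) /= ->.
split=> //; apply: (basic_iso_B L_simples P_cover e_sum e_idem e_orth iota_inj iotaP
  eta_bij eta_nat D_simple P_filt Delta_filt A_conn) => // i iltn.
have : i \in [set: 'I_n] :\ l.
  by rewrite !inE andbT -val_eqE /=; lia.
by rewrite -imk => /imsetP[j _ ->].
Qed.
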